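(* In the setting of the context (in particular $\delta,h_0,h_1$ chosen as stated there and $U\ge1$), assume $\beta''\in L^2(\mathbb R)$. Then $$\mathbb E\Big[\int_{\mathbb R}|\beta'_{N,T}(y)-\beta'(y)|^2dy\Big]\lesssim\omega^{-2}\Big(\mathbb E\Big[\int_{\mathbb R}|\Psi_{N,T}(y)-\Psi(y)|^2dy\Big]+N_T^{-1}\Big)+N_T^{-1}\int_{|\mathcal F(\pi)(z)|>2\omega}|\mathcal F(\beta')(z)|^2|\mathcal F(\pi)(z)|^{-2}z^2dz+\int_{|\mathcal F(\pi)(z)|\le2\omega}|\mathcal F(\beta')(z)|^2dz.$$
   Context: Model. Let $B^i$, $i\ge1$, be independent standard Brownian motions and $X_0^i$ i.i.d. real random variables; for $1\le i\le N$, $$X_t^{i,N}=X_0^i+B_t^i-\frac1{2N}\sum_{j=1}^N\int_0^t\varphi'(X_s^{i,N}-X_s^{j,N})\,ds,\qquad Y_t^{i,N}=X_t^{i,N}-\frac1N\sum_{j=1}^NX_t^{j,N},\quad t\ge0.$$ Only $Y_T^{1,N},\dots,Y_T^{N,N}$ are observed. The function $\varphi$ has the form $$\varphi(y)=\sum_{0<j\le J}a_j\varphi_j(y)+\beta(y),\quad \varphi_j(y)=y^{2j}\ (0<j\le J_1),\quad \varphi_j(y)=\cos(\theta_jy)\ (J_1<j\le J),$$ with known integers $1\le J_1\le J$, known distinct $\theta_j>0$, unknown $a_1>0$, $a_2,\dots,a_{J_1-1}\ge0$, $a_{J_1}>0$, $a_{J_1+1},\dots,a_J\in\mathbb R$,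 and unknown even bounded $\beta\in C^2(\mathbb R)$ with $\beta'$ bounded and $\beta'\in L^1(\mathbb R)$. It is assumed that, for some $\lambda>0$, $2a_1-\sum_{J_1<j\le J}\theta_j^2|a_j|+\beta''(y)\ge\lambda$ for all $y$ (inducing $\varphi''\ge\lambda$), and that $|\varphi'(x)-\varphi'(y)|\le|x-y|\,|P(x)+P(y)|$ for some polynomial $P$. Invariant density. The mean field equation $\overline X_t=\overline X_0+B_t-\frac12\int_0^t(\varphi'\star\mu_s)(\overline X_s)ds$, $\mu_t=\mathrm{Law}(\overline X_t)$, admits a symmetric invariant density $\pi$ with $\pi(x)=Z_\pi^{-1}\exp(-(\varphi\star\pi)(x))$, $Z_\pi=\int_{\mathbb R}\exp(-(\varphi\star\pi)(x))dx$; $\Pi$ is the law with density $\pi$. Let $\Pi_{N,T}=N^{-1}\sum_{i=1}^N\delta_{Y_T^{i,N}}$ and $W_1$ the Wasserstein 1-distance. It is known (Malrieu 2003), and taken as given, that there are constants $C_1,C_2>0$ independent of $N,T$ with $\mathbb E[W_1^2(\Pi_{N,T},\Pi)]\le C_1N^{-1}+C_2\exp(-\lambda T)=:N_T^{-1}$. Notation. $m_k=\int y^k\pi(y)dy$; $\mathcal F(f)(z)=\int e^{\mathrm izy}f(y)dy$ and $\mathcal F(\Pi_{N,T})(z)=\frac1N\sum_{i=1}^N e^{\mathrm izY_T^{i,N}}$; $\|f\|_\infty=\sup|f|$; $f_u(x)=u^{-1}f(u^{-1}x)$. Put $\alpha_0=\sum_{0<k\le J_1}m_{2k}a_k$, $\alpha_j=\sum_{j\le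 k\le J_1}\binom{2k}{2j}m_{2(k-j)}a_k$ for $0<j\le J_1$, $\alpha_j=a_j\mathcal F(\pi)(\theta_j)$ for $J_1<j\le J$, $\bar\alpha_1=\sum_{0<j\le J_1}\alpha_j$. Set $l(y)=\pi'(y)/\pi(y)$, $l(y,\boldsymbol\alpha)=-\sum_{j=1}^J\alpha_j\varphi_j'(y)$, $\Psi=-\beta'\star\pi$, so $l(y)=l(y,\boldsymbol\alpha)+\Psi(y)$ for the true $\boldsymbol\alpha=(\alpha_1,\dots,\alpha_J)^\top$. Estimators. $K$ is a smooth kernel of order $m\ge2$: $\int K=1$, $\int x^jK(x)dx=0$ for $1\le j\le m-1$, $\int x^mK(x)dx\ne0$. Put $$\pi_{N,T}(y)=\frac1N\sum_{i=1}^NK_{h_0}(y-Y_T^{i,N}),\quad \pi'_{N,T}(y)=\frac1{Nh_1}\sum_{i=1}^NK'_{h_1}(y-Y_T^{i,N}),\quad l_{N,T}=\frac{\pi'_{N,T}}{\pi_{N,T}}\mathbf 1_{\{\pi_{N,T}>\delta\}},$$ where $K'_{h_1}(x)=h_1^{-1}K'(x/h_1)$, with $h_0=N_T^{-1/(2(m+1))}$, $h_1=N_T^{-1/(2(m+2))}$, $\delta=\delta_0\exp(-\bar\alpha_1U^{2J_1})$, $\delta_0=(2Z_\pi)^{-1}\exp(-\alpha_0-\sum_{J_1<j\le J}|\alpha_j|-\|\beta\|_\infty)$, where $U=U_{N,T}\ge1$, $U\to\infty$. Let $w$ be an integrable weight function with support $[\epsilon,1]$, $\epsilon\in(0,1)$,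 and $$\boldsymbol\alpha_{N,T}=\arg\min_{\boldsymbol\alpha\in\mathbb R^J}\int(l_{N,T}(y)-l(y,\boldsymbol\alpha))^2w_U(y)dy,\qquad \Psi_{N,T}(y)=(l_{N,T}(y)-l(y,\boldsymbol\alpha_{N,T}))\mathbf 1_{\{|y|\le\epsilon U\}}.$$ For a threshold $\omega=\omega_{N,T}>0$, $\omega\to0$, let $$\mathcal F(\beta'_{N,T})(z)=-\frac{\mathcal F(\Psi_{N,T})(z)\overline{\mathcal F(\Pi_{N,T})(z)}}{|\mathcal F(\Pi_{N,T})(z)|^2}\mathbf 1_{\{|\mathcal F(\Pi_{N,T})(z)|>\omega\}},\qquad \beta'_{N,T}(y)=\frac1{2\pi}\int e^{-\mathrm izy}\mathcal F(\beta'_{N,T})(z)dz$$ (in the last formula $\frac{1}{2\pi}$ contains the number $\pi$). The asymptotics are $N,T\to\infty$ (so $N_T\to\infty$); $a\lesssim b$ means $a\le\mathrm{const}\cdot b$ with a constant independent of $N,T$ (and of $U,\omega$). *)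

(* Defs.v *)
From HB Require Import structures.
From mathcomp Require Import all_boot all_order all_algebra.
From mathcomp Require Import all_classical all_reals all_analysis.
From mathcomp Require Import complex.
Set Implicit Arguments.
Unset Strict Implicit.
Unset Printing Implicit Defensive.
Import Order.TTheory GRing.Theory Num.Theory.
Import numFieldNormedType.Exports.
Local Open Scope classical_set_scope.
Local Open Scope ring_scope.
Local Open Scope complex_scope.

(* In this development [pi] is the number; the invariant density is [dens].   *)

(* Derivatives of functions; in ring_scope these notations otherwise denote
   formal derivatives of polynomials. *)
Notation "f ^` ()" := (derive1 f) : ring_scope.
Notation "f ^` ( n )" := (derive1n n f) : ring_scope.

Notation leb := lebesgue_measure.
Notation normc := ComplexField.Normc.normc.

(** * Fourier transforms *)

Definition cis (R : realType) (t : R) : R[i] := cos t +i* sin t.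

Definition cintegral (R : realType) (D : set R) (f : R -> R[i]) : R[i] :=
  (\int[leb]_(x in D) complex.Re (f x)) +i* (\int[leb]_(x in D) complex.Im (f x)).

Definition fourier (R : realType) (f : R -> R) (z : R) : R[i] :=
  cintegral setT (fun y => cis (z * y) * (f y)%:C).

Definition inv_fourier_trunc (R : realType) (G : R -> R[i]) (n : nat) (y : R)
    : R[i] :=
  ((2 * pi)^-1)%:C *
  cintegral `[- n%:R, n%:R] (fun z => cis (- (z * y)) * G z).

(* g = (2 pi)^-1 \int e^{-izy} G(z) dz as a limit in mean: G is only assumed
   to be square-integrable, as is the case of the estimated transform below,
   whose cut-off does not restrict z to a bounded set. *)
Definition is_inv_fourier (R : realType) (G : R -> R[i]) (g : R -> R) : Prop :=
  measurable_fun setT g /\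
  (fun n => \int[leb]_y
     ((normc ((g y)%:C - inv_fourier_trunc G n y)) ^+ 2)%:E)%E @ \oo --> 0%E.

Definition conv (R : realType) (f g : R -> R) (x : R) : R :=
  \int[leb]_y (f (x - y) * g y).

(** * Wasserstein distance *)

Definition is_coupling (R : realType) (mu nu : set R -> \bar R)
    (gam : probability (R * R)%type R) : Prop :=
  forall A : set R, measurable A ->
    gam (A `*` setT) = mu A /\ gam (setT `*` A) = nu A.

Definition W1 (R : realType) (mu nu : set R -> \bar R) : \bar R :=
  ereal_inf [set (\int[gam]_q `|q.1 - q.2|%:E)%E | gam in is_coupling mu nu].

Definition density_law (R : realType) (f : R -> R) (A : set R) : \bar R :=
  (\int[leb]_(x in A) (f x)%:E)%E.

Definition empirical_law (R : realType) (N : nat) (Y : 'I_N -> R) (A : set R)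
    : \bar R :=
  ((N%:R^-1)%:E * \sum_(i < N) \d_(Y i) A)%E.

(** * Independence and Brownian motion *)

Section Noise.
Context (d : measure_display) (Omega : measurableType d) (R : realType).
Variable P : probability Omega R.

Definition sigma_process (I : Type) (D : set I) (X : I -> Omega -> R)
    : set (set Omega) :=
  <<s \bigcup_(t in D) preimage_set_system setT (X t) measurable >>.

Definition sigma_variable (X : Omega -> R) : set (set Omega) :=
  preimage_set_system setT X measurable.

Definition mutually_independent (I : eqType) (F : I -> set (set Omega)) : Prop :=
  forall (s : seq I) (A : I -> set Omega), uniq s ->
    (forall i, i \in s -> F i (A i)) ->
    P (\big[setI/setT]_(i <- s) A i) = (\prod_(i <- s) P (A i))%E.

Definition independent (F G : set (set Omega)) : Prop :=
  forall A B, F A -> G B -> P (A `&` B) = (P A * P B)%E.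

Record brownian (B : R -> {RV P >-> R}) : Prop := Brownian {
  brownian0 : {ae P, forall om, B 0 om = 0};
  brownian_continuous :
    {ae P, forall om, {within `[0, +oo[, continuous (fun t => B t om)}};
  brownian_gaussian : forall s t, 0 <= s -> s < t ->
    forall A : set R, measurable A ->
      P ((fun om => B t om - B s om) @^-1` A) =
      normal_prob 0 (Num.sqrt (t - s)) A;
  brownian_indep : forall s t, 0 <= s -> s < t ->
    independent (sigma_process `[0, s] (fun r => B r : Omega -> R))
                (sigma_variable (fun om => B t om - B s om)) }.

(* B i and X0 i stand for the (i+1)-st Brownian motion and initial value. *)
Record driving_noise (B : nat -> R -> {RV P >-> R}) (X0 : nat -> {RV P >-> R})
    : Prop := DrivingNoise {
  noise_brownian : forall i, brownian (B i);
  noise_identical : forall i A, measurable A ->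
    distribution P (X0 i) A = distribution P (X0 0%N) A;
  noise_indep : mutually_independent (fun i : nat + nat =>
    match i with
    | inl k => sigma_process `[0, +oo[ (fun t => B k t : Omega -> R)
    | inr k => sigma_variable (X0 k)
    end) }.

End Noise.

(** * The interaction function *)

(* phi(y) = sum_(1 <= j <= dim) coef j * basis j y + beta y, with
   basis j y = y^(2j) for j <= deg and cos (freq j * y) for j > deg; thus deg
   and dim are J_1 and J, and only the values coef j for 1 <= j <= dim and
   freq j for deg < j <= dim matter. *)
Record interaction (R : realType) := Interaction {
  deg : nat;
  dim : nat;
  freq : nat -> R;
  coef : nat -> R;
  beta : R -> R }.

Definition basis (R : realType) (p : interaction R) (j : nat) (y : R) : R :=
  if (j <= deg p)%N then y ^+ (2 * j) else cos (freq p j * y).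

Definition phi (R : realType) (p : interaction R) (y : R) : R :=
  \sum_(1 <= j < (dim p).+1) coef p j * basis p j y + beta p y.

Record admissible (R : realType) (p : interaction R) (lam : R) : Prop :=
    Admissible {
  adm_deg : (1 <= deg p <= dim p)%N;
  adm_freq_gt0 : forall j, (deg p < j <= dim p)%N -> 0 < freq p j;
  adm_freq_inj : forall j k, (deg p < j <= dim p)%N -> (deg p < k <= dim p)%N ->
    freq p j = freq p k -> j = k;
  adm_coef1 : 0 < coef p 1;
  adm_coef_mid : forall j, (2 <= j < deg p)%N -> 0 <= coef p j;
  adm_coef_deg : 0 < coef p (deg p);
  adm_even : forall y, beta p (- y) = beta p y;
  adm_bounded : exists M : R, forall y, `|beta p y| <= M;
  adm_derivable : forall y, derivable (beta p) y 1;
  adm_derivable2 : forall y, derivable (beta p)^`() y 1;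
  adm_C2 : continuous ((beta p)^`()^`() : R -> R);
  adm_bounded1 : exists M : R, forall y, `|(beta p)^`() y| <= M;
  adm_integrable1 : leb.-integrable setT (EFin \o (beta p)^`());
  adm_lam : 0 < lam;
  adm_convex : forall y,
    lam <= 2 * coef p 1
           - \sum_((deg p).+1 <= j < (dim p).+1) freq p j ^+ 2 * `|coef p j|
           + (beta p)^`()^`() y;
  adm_growth : exists Q : {poly R}, forall x y,
    `|(phi p)^`() x - (phi p)^`() y| <= `|x - y| * `|Q.[x] + Q.[y]| }.

(** * Particle system, mean field limit and invariant density *)

Section Dynamics.
Context (d : measure_display) (Omega : measurableType d) (R : realType).
Variables (P : probability Omega R) (p : interaction R).

Definition particle_system (B : nat -> R -> {RV P >-> R})
    (X0 : nat -> {RV P >-> R}) (X : forall N, 'I_N -> R -> {RV P >-> R}) : Prop :=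
  forall N (i : 'I_N),
    {ae P, forall om, {within `[0, +oo[, continuous (fun t => X N i t om)}} /\
    {ae P, forall om, forall t, 0 <= t ->
      X N i t om = X0 i om + B i t om
        - (2 * N%:R)^-1 * \sum_(j < N)
            \int[leb]_(s in `[0, t]) (phi p)^`() (X N i s om - X N j s om)}.

Definition centered (X : forall N, 'I_N -> R -> {RV P >-> R}) (N : nat) (T : R)
    (om : Omega) (i : 'I_N) : R :=
  X N i T om - N%:R^-1 * \sum_(j < N) X N j T om.

(* \phi' \star \mu for \mu the law of the random variable Z *)
Definition mean_field_force (Z : {RV P >-> R}) (x : R) : R :=
  \int[distribution P Z]_y (phi p)^`() (x - y).

Record mean_field_solution (B : R -> {RV P >-> R}) (X0 : {RV P >-> R})
    (X : R -> {RV P >-> R}) : Prop := MeanFieldSolution {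
  mf_continuous :
    {ae P, forall om, {within `[0, +oo[, continuous (fun t => X t om)}};
  mf_force : forall t, 0 <= t -> forall x,
    (distribution P (X t)).-integrable setT
      (EFin \o (fun y => (phi p)^`() (x - y)));
  mf_drift : {ae P, forall om, forall t, 0 <= t ->
    leb.-integrable `[0, t] (EFin \o (fun s => mean_field_force (X s) (X s om)))};
  mf_equation : {ae P, forall om, forall t, 0 <= t ->
    X t om = X0 om + B t om
      - 2^-1 * \int[leb]_(s in `[0, t]) mean_field_force (X s) (X s om)} }.

End Dynamics.
Arguments centered {d Omega R P} X N T om i.

Definition stationary_density (R : realType) (p : interaction R) (dens : R -> R)
    : Prop :=
  exists (d : measure_display) (Omega : measurableType d)
    (P : probability Omega R) (B : R -> {RV P >-> R}) (X0 : {RV P >-> R})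
    (X : R -> {RV P >-> R}),
    [/\ brownian B,
        independent P (sigma_variable X0)
          (sigma_process `[0, +oo[ (fun t => B t : Omega -> R)),
        mean_field_solution p B X0 X
      & forall t, 0 <= t -> forall A, measurable A ->
          distribution P (X t) A = density_law dens A].

Definition Zpi (R : realType) (p : interaction R) (dens : R -> R) : R :=
  \int[leb]_x expR (- conv (phi p) dens x).

Record invariant_density (R : realType) (p : interaction R) (dens : R -> R)
    : Prop := InvariantDensity {
  inv_measurable : measurable_fun setT dens;
  inv_ge0 : forall x, 0 <= dens x;
  inv_mass : (\int[leb]_x (dens x)%:E = 1)%E;
  inv_symmetric : forall x, dens (- x) = dens x;
  inv_stationary : stationary_density p dens;
  inv_conv : forall x,
    leb.-integrable setT (EFin \o (fun y => phi p (x - y) * dens y));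
  inv_partition : leb.-integrable setT
    (EFin \o (fun x => expR (- conv (phi p) dens x)));
  inv_fixpoint : forall x,
    dens x = (Zpi p dens)^-1 * expR (- conv (phi p) dens x) }.

Section Coefficients.
Variables (R : realType) (p : interaction R) (dens : R -> R).

Definition moment (k : nat) : R := \int[leb]_y (y ^+ k * dens y).

(* The last case is real, as dens is symmetric. *)
Definition alpha (j : nat) : R :=
  if j == 0%N then \sum_(1 <= k < (deg p).+1) moment (2 * k) * coef p k
  else if (j <= deg p)%N then
    \sum_(j <= k < (deg p).+1)
      'C(2 * k, 2 * j)%:R * moment (2 * (k - j)) * coef p k
  else coef p j * complex.Re (fourier dens (freq p j)).

Definition alpha_bar : R := \sum_(1 <= j < (deg p).+1) alpha j.

Definition sup_norm (f : R -> R) : R := sup (range (fun y => `|f y|)).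

Definition delta0 : R :=
  (2 * Zpi p dens)^-1 *
  expR (- alpha 0 - \sum_((deg p).+1 <= j < (dim p).+1) `|alpha j|
        - sup_norm (beta p)).

Definition delta (U : R) : R := delta0 * expR (- (alpha_bar * U ^+ (2 * deg p))).

Definition Psi (y : R) : R := - conv (beta p)^`() dens y.

End Coefficients.

(** * Estimators *)

Section Estimators.
Variable R : realType.

Definition rescale (u : R) (f : R -> R) (x : R) : R := u^-1 * f (u^-1 * x).

Record smooth_kernel (m : nat) (K : R -> R) : Prop := SmoothKernel {
  kernel_smooth : forall n x, derivable (K^`(n)) x 1;
  kernel_integrable : forall j, (j <= m)%N ->
    leb.-integrable setT (EFin \o (fun x => x ^+ j * K x));
  kernel_mass : \int[leb]_x K x = 1;
  kernel_moment : forall j, (1 <= j <= m.-1)%N -> \int[leb]_x (x ^+ j * K x) = 0;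
  kernel_order : \int[leb]_x (x ^+ m * K x) != 0 }.

(* The support is that of the measure w(y) dy. *)
Record weight (eps : R) (w : R -> R) : Prop := Weight {
  weight_ge0 : forall y, 0 <= w y;
  weight_integrable : leb.-integrable setT (EFin \o w);
  weight_support :
    [set y | forall r, 0 < r -> (0 < \int[leb]_(x in ball y r) (w x)%:E)%E] =
    [set` `[eps, 1]] }.

(* N_T, so that N_T^{-1} = C1 / N + C2 exp(- lam T). *)
Definition rate (C1 C2 lam : R) (N : nat) (T : R) : R :=
  (C1 * N%:R^-1 + C2 * expR (- (lam * T)))^-1.

Definition bandwidth0 (m : nat) (NT : R) : R := NT `^ (- (2 * m.+1)%:R^-1).
Definition bandwidth1 (m : nat) (NT : R) : R := NT `^ (- (2 * m.+2)%:R^-1).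

(* In the following Y is the observed sample. *)
Definition density_est (K : R -> R) (h0 : R) N (Y : 'I_N -> R) (y : R) : R :=
  N%:R^-1 * \sum_(i < N) rescale h0 K (y - Y i).

Definition derivative_est (K : R -> R) (h1 : R) N (Y : 'I_N -> R) (y : R) : R :=
  (N%:R * h1)^-1 * \sum_(i < N) rescale h1 K^`() (y - Y i).

Definition score_est (K : R -> R) (h0 h1 dlt : R) N (Y : 'I_N -> R) (y : R) : R :=
  if dlt < density_est K h0 Y y
  then derivative_est K h1 Y y / density_est K h0 Y y else 0.

(* l(y, a); the entry i of the row vector a is the coefficient of index i+1. *)
Definition score_par (p : interaction R) (y : R) (a : 'rV[R]_(dim p)) : R :=
  - \sum_(i < dim p) a 0 i * (basis p i.+1)^`() y.

Definition contrast (p : interaction R) (l w : R -> R) (U : R)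
    (a : 'rV[R]_(dim p)) : \bar R :=
  (\int[leb]_y ((l y - score_par y a) ^+ 2 * rescale U w y)%:E)%E.

Definition is_argmin (V : Type) (f : V -> \bar R) (a : V) : Prop :=
  forall b, (f a <= f b)%E.

Definition Psi_est (p : interaction R) (l : R -> R) (a : 'rV[R]_(dim p))
    (eps U y : R) : R :=
  if `|y| <= eps * U then l y - score_par y a else 0.

Definition empirical_fourier N (Y : 'I_N -> R) (z : R) : R[i] :=
  (N%:R^-1)%:C * \sum_(i < N) cis (z * Y i).

Definition fourier_beta'_est N (Y : 'I_N -> R) (PsiNT : R -> R) (thr : R) (z : R)
    : R[i] :=
  if thr < normc (empirical_fourier Y z) then
    - (fourier PsiNT z * conjc (empirical_fourier Y z)
       / (normc (empirical_fourier Y z) ^+ 2)%:C)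
  else 0.

End Estimators.

(* Main.v *)
From HB Require Import structures.
From mathcomp Require Import all_boot all_order all_algebra.
From mathcomp Require Import all_classical all_reals all_analysis.
From mathcomp Require Import measurable_realfun complex ring lra.
Require Import Defs.
Set Implicit Arguments.
Unset Strict Implicit.
Unset Printing Implicit Defensive.
Import Order.TTheory GRing.Theory Num.Theory.
Import numFieldNormedType.Exports.
Local Open Scope classical_set_scope.
Local Open Scope ring_scope.
Local Open Scope complex_scope.

(** Fix a sample point. Write f for the derivative of the function beta, F for
    its Fourier transform, q for the transform of the invariant density, e for
    the transform of the empirical law, w for the threshold and G for the
    estimated transform. Since Psi = - (f * density), the convolution theorem
    gives the transform - F q for Psi. Hence, where |e| > w, the difference G
    - F is the sum of an error coming from Psi, namely the transform of
    (estimated Psi - Psi) divided by - e, and of F (q - e) / e; where |e| <= w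
    it is - F. In the second case either |q| <= 2 w, or |q| <= 2 |e - q|, so
    that the missing part of F is at most 2 |F| |e - q| / |q|. This yields the
    pointwise bound [threshold_error], whose part that does not involve the
    estimate of Psi is called [error_density].

    The estimator of f is defined from G by a limit in mean, so a Plancherel
    inequality is needed in both directions. It is proved here with Abel
    means: inserting exp (- t |z|) turns the integral of the square of a
    Fourier transform into a quadratic form built from the Poisson kernel 2 t
    / (t^2 + u^2). That kernel is nonnegative with integral 2 pi, so the form
    is bounded by 2 pi times the square of the L2 norm, and Fatou's lemma
    removes the weight ([bessel]). The same weight gives the pointwise
    inversion formula for f ([inversion]), which requires F to be integrable.
    This is where the square integrability of f' enters: integrating by parts
    against the cut-off 1 - (x/n)^2 on [-n, n] and applying [bessel] shows
    that z F(z) is square integrable ([integral_trig_transform_deriv]), and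
    then F is integrable by comparison with 1 / (1 + z^2). Inversion for f
    together with [bessel] applied to G - F gives [inv_fourier_error]: the
    squared L2 distance between the estimator and f is at most a constant
    times that between G and F. Together with the pointwise bound this is
    [sample_error].

    It remains to take expectations. For any coupling of the empirical law
    with the invariant law, the difference of the expectations of cos (z x) or
    sin (z x) is at most |z| times the cost of the coupling, so each of the
    two components of e - q is at most |z| times the Wasserstein distance
    ([W1_trig_le]). Therefore the expectation of |e - q|^2 is at most 2 z^2 /
    N_T, and Tonelli's theorem ([mean_integral_error_density]) produces
    exactly the terms of the statement; the factor z^2 multiplied by w^-2
    |F|^2 is absorbed by the finite integral of z^2 |F(z)|^2.

    Transforms are handled through their real and imaginary parts, the cosine
    and sine transforms, which are treated together by [trig_transform]. The
    estimate of Psi need not depend measurably on the sample point, because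
    the minimiser of the contrast is arbitrary; the integral of a nonnegative
    function that is not measurable is a lower integral, and
    [lower_integral_le] is the form of subadditivity that it satisfies. *)

(** * Integrals of nonnegative functions and Fubini's theorem *)

Section MeasureTools.
Local Open Scope ereal_scope.
Context d (T : measurableType d) (R : realType).
Variable mu : {measure set T -> \bar R}.

Import HBNNSimple.

(** Fatou's lemma in the form in which it is used: a bound on each integral
    that converges is inherited by the pointwise limit. *)
Lemma fatou_bound (f_ : nat -> T -> \bar R) (f : T -> \bar R)
    (v : nat -> \bar R) (l : \bar R) :
  (forall n, measurable_fun [set: T] (f_ n : T -> \bar R)) -> (forall n x, 0 <= f_ n x) ->
  (forall x, f_ ^~ x @ \oo --> f x) ->
  (forall n, \int[mu]_x f_ n x <= v n) -> v @ \oo --> l ->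
  \int[mu]_x f x <= l.
Proof.
move=> mf f0 fcvg fv vl.
have := fatou mu measurableT mf (fun n x _ => f0 n x).
under eq_integral do rewrite (cvg_limn_einf_sup (fcvg _)).1.
move=> /le_trans; apply; rewrite -(cvg_limn_einf_sup vl).1.
rewrite !limn_einf_lim; apply: lee_lim.
- exact: is_cvg_einfs.
- exact: is_cvg_einfs.
- apply: nearW => n; apply: le_ereal_inf_tmp => _ [k /= nk <-].
  by apply: le_trans (fv k); apply: ereal_inf_lbound; exists k.
Qed.

(** The integral of a nonnegative function is a supremum over the simple
    functions below it, hence is monotone even between functions that are not
    measurable. *)
Lemma ge0_le_lower_integral (f g : T -> \bar R) :
  (forall x, 0 <= f x) -> (forall x, f x <= g x) ->
  \int[mu]_x f x <= \int[mu]_x g x.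
Proof.
move=> f0 fg; have g0 x : 0 <= g x by exact: le_trans (f0 x) (fg x).
rewrite !ge0_integralTE//; apply: ereal_sup_le => _ [h hf <-].
by exists h => // x; exact: le_trans (hf x) (fg x).
Qed.

(** For functions that are not measurable the integral is only superadditive.
    Subadditivity survives when one summand is measurable: if a simple
    function h lies below c a + b, then the measurable function max (0, h - b)
    lies below c a. *)
Lemma lower_integral_le (c : R) (g a b : T -> \bar R) : (0 < c)%R ->
  (forall x, 0 <= g x) -> (forall x, 0 <= a x) -> (forall x, 0 <= b x) ->
  measurable_fun setT b -> (forall x, g x <= c%:E * a x + b x) ->
  \int[mu]_x g x <= c%:E * \int[mu]_x a x + \int[mu]_x b x.
Proof.
move=> c0 g0 a0 b0 mb gab.
rewrite [leLHS]ge0_integralTE//; apply: ge_ereal_sup => _ [h hg <-].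
rewrite -integralT_nnsfun.
pose k x := maxe 0 ((h x)%:E - b x).
have mk : measurable_fun setT k.
  apply: measurable_maxe => //; apply: emeasurable_funB => //.
  exact/measurable_EFinP.
have k0 x : 0 <= k x by rewrite /k le_max lexx.
have hkb x : (h x)%:E <= k x + b x.
  rewrite /k; case: (b x) (b0 x) => [r||] // r0.
    rewrite -EFinB /maxe lte_fin; case: ltP => [_|hr].
      by rewrite -EFinD lee_fin subrK.
    by rewrite add0e lee_fin -subr_le0.
  by rewrite addey ?leey// (@lt_le_trans _ _ 0)// le_max lexx.
have ka x : c^-1%:E * k x <= a x.
  rewrite lee_pdivrMl// /k ge_max; apply/andP; split.
    by apply: mule_ge0 => //; rewrite lee_fin ltW.
  have := le_trans (hg x) (gab x).
  case: (b x) (b0 x) => [r||] // r0; last by rewrite addeNy leNye.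
  by rewrite leeBlDr.
apply: (@le_trans _ _ (\int[mu]_x k x + \int[mu]_x b x)).
  rewrite -ge0_integralD//; apply: ge0_le_integral => //.
  - by move=> x _; rewrite lee_fin.
  - exact/measurable_EFinP.
  - exact: emeasurable_funD.
apply: leeD2r; rewrite -lee_pdivrMl// -ge0_integralZl ?lee_fin ?invr_ge0 ?(ltW c0)//.
apply: ge0_le_lower_integral => // x.
by apply: mule_ge0; rewrite // lee_fin invr_ge0 ltW.
Qed.

End MeasureTools.

Section Fubini.
Context d1 d2 (T1 : measurableType d1) (T2 : measurableType d2) (R : realType).
Variables (m1 : {sigma_finite_measure set T1 -> \bar R})
  (m2 : {sigma_finite_measure set T2 -> \bar R}).

Lemma measurable_Rintegral_param (h : T1 * T2 -> R) : measurable_fun setT h ->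
  measurable_fun setT (fun x => \int[m2]_y h (x, y)).
Proof.
move=> mh; apply: measurableT_comp; first exact: fine_measurable.
have mhE : measurable_fun setT (EFin \o h) by exact/measurable_EFinP.
rewrite (_ : (fun _ => _) =
  (fun x => \int[m2]_y ((EFin \o h)^\+ (x, y)) - \int[m2]_y ((EFin \o h)^\- (x, y)))%E).
  apply: emeasurable_funB.
  - apply: (measurable_fun_fubini_tonelli_F (fun q => (EFin \o h)^\+%E q)) => //.
    exact: measurable_funepos.
  - apply: (measurable_fun_fubini_tonelli_F (fun q => (EFin \o h)^\-%E q)) => //.
    exact: measurable_funeneg.
apply/funext => x; rewrite integralE.
by congr (_ - _)%E; apply: eq_integral => y _; rewrite ?funeposE ?funenegE.
Qed.

(** The integrability of every section, and not just of almost every one,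
    makes the real-valued inner integrals agree with the extended ones
    everywhere. *)
Lemma Rfubini (h : T1 * T2 -> R) : measurable_fun setT h ->
  (\int[m1]_x \int[m2]_y `|h (x, y)|%:E < +oo)%E ->
  (forall x, m2.-integrable setT (fun y => (h (x, y))%:E)) ->
  (forall y, m1.-integrable setT (fun x => (h (x, y))%:E)) ->
  \int[m1]_x (\int[m2]_y h (x, y)) = \int[m2]_y (\int[m1]_x h (x, y)).
Proof.
move=> mh hoo h1 h2.
have ih : (m1 \x m2)%E.-integrable setT (EFin \o h).
  by apply/integrable12ltyP => //; exact/measurable_EFinP.
rewrite {1 3}/Rintegral; congr fine.
have := Fubini ih.
rewrite /= => E; transitivity (\int[m1]_x \int[m2]_y (h (x, y))%:E)%E.
  by apply: eq_integral => x _; rewrite fineK//; exact: integrable_fin_num (h1 x).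
rewrite E; apply: eq_integral => y _; rewrite fineK//.
exact: integrable_fin_num (h2 y).
Qed.

End Fubini.

(** * Affine changes of variables *)

Section Affine.
Context (R : realType).

Definition affine (t c : R) (x : measurableTypeR R) : measurableTypeR R := t * x + c.

Lemma measurable_affine (t c : R) : measurable_fun setT (affine t c).
Proof. by apply: measurable_funD => //; exact: measurable_funM. Qed.

HB.instance Definition _ (t c : R) :=
  isMeasurableFun.Build _ _ _ _ (affine t c) (@measurable_affine t c).

(** The image of the Lebesgue measure under x |-> t x + c, rescaled by t; it
    is again the Lebesgue measure. *)
Definition affine_image (t c : R) (t0 : 0 < t) :
    {measure set (measurableTypeR R) -> \bar R} :=
  mscale (NngNum (ltW t0))
    (measure_function_pushforward__canonical__measure_function_Measure leb
      (@measurable_affine t c)).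

Lemma lebesgue_measure_affine (t c : R) (A : set R) (t0 : 0 < t) :
  measurable A -> leb A = affine_image c t0 A.
Proof.
move=> mA; apply: lebesgue_measure_unique => // _ [[a b]] _ <-.
change (leb `]a, b]%classic = t%:E * leb (affine t c @^-1` `]a, b]))%E.
rewrite (_ : affine t c @^-1` `]a, b] = `](a - c) / t, (b - c) / t]%classic).
  rewrite !lebesgue_measure_itv/= !lte_fin ltr_pM2r ?invr_gt0// ltrD2r.
  case: ifPn => ab; last by rewrite mule0.
  by rewrite -!EFinD -EFinM; congr EFin; field; rewrite gt_eqF.
apply/seteqP; split => x; rewrite /affine /= !in_itv/=;
  by rewrite ltr_pdivrMr// ler_pdivlMr// ltrBlDr lerBrDr mulrC.
Qed.

Lemma ge0_integral_affine (t c : R) (f : R -> \bar R) : 0 < t ->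
  measurable_fun setT f -> (forall x, 0 <= f x)%E ->
  (t%:E * \int[leb]_x f (t * x + c)%R = \int[leb]_x f x)%E.
Proof.
move=> t0 mf f0.
have -> : (\int[leb]_x f x = \int[affine_image c t0]_x f x)%E.
  apply: (@eq_measure_integral _ _ _ _ (affine_image c t0) leb) => A mA _.
  exact: lebesgue_measure_affine.
rewrite /affine_image ge0_integral_mscale//; congr (_ * _)%E.
symmetry; apply: (ge0_integral_pushforward (@measurable_affine t c) leb measurableT) => //.
Qed.

Lemma integrable_affine (t c : R) (f : R -> R) : 0 < t ->
  leb.-integrable setT (EFin \o f) ->
  leb.-integrable setT (fun x => (f (t * x + c))%:E).
Proof.
move=> t0 /integrableP[mf foo].
have mfa : measurable_fun setT (fun x => (f (t * x + c))%:E).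
  by apply: (measurableT_comp mf); exact: measurable_affine.
apply/integrableP; split => //.
have mf' : measurable_fun setT (fun x : R => `|(f x)%:E|%E).
  exact: measurableT_comp.
have := ge0_integral_affine c t0 mf' (fun=> abse_ge0 _).
move=> /(congr1 (fun x => x < +oo)%E); rewrite foo.
have : (0 <= \int[leb]_x `|(f (t * x + c))%:E|)%E by apply: integral_ge0.
by case: (X in (0 <= X)%E) => [s _ _|_|//]; rewrite ?ltry// gt0_muley.
Qed.

Lemma Rintegral_affine (t c : R) (f : R -> R) : 0 < t ->
  leb.-integrable setT (EFin \o f) ->
  \int[leb]_x f (t * x + c) = t^-1 * \int[leb]_x f x.
Proof.
move=> t0 intf; have [mf _] := integrableP _ _ _ intf.
apply: (mulfI (lt0r_neq0 t0)); rewrite mulrA divff ?gt_eqF// mul1r.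
have ia := integrable_affine c t0 intf.
rewrite -RintegralZl// /Rintegral; congr fine.
under eq_integral do rewrite EFinM.
rewrite integralZl//.
rewrite integralE muleBr//; last first.
  apply: fin_num_adde_defr; apply: integrable_pos_fin_num => //.
rewrite [RHS]integralE; congr (_ - _)%E.
  rewrite -[RHS](@ge0_integral_affine t c (EFin \o f)^\+%E)//.
    by congr (_ * _)%E; apply: eq_integral => x _; rewrite !funeposE.
  exact: measurable_funepos.
rewrite -[RHS](@ge0_integral_affine t c (EFin \o f)^\-%E)//.
  by congr (_ * _)%E; apply: eq_integral => x _; rewrite !funenegE.
exact: measurable_funeneg.
Qed.

End Affine.

(** * The Poisson kernel *)

Section Poisson.
Context (R : realType).
Implicit Types t u z c : R.

(** The Fourier transform of exp (- t |z|). *)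
Definition poisson t u : R := 2 * t / (t ^+ 2 + u ^+ 2).

Lemma poisson_den_gt0 t u : 0 < t -> 0 < t ^+ 2 + u ^+ 2.
Proof. by move=> t0; rewrite ltr_pwDl ?exprn_gt0// sqr_ge0. Qed.

Lemma poisson_ge0 t u : 0 < t -> 0 <= poisson t u.
Proof.
move=> t0; rewrite divr_ge0 ?mulr_ge0 ?(ltW t0)//.
by rewrite ltW// poisson_den_gt0.
Qed.

Lemma continuous_poisson t : 0 < t -> continuous (poisson t).
Proof.
move=> t0 u; apply: cvgM; first exact: cvg_cst.
apply: cvgV; first by rewrite gt_eqF// poisson_den_gt0.
by apply: cvgD; [exact: cvg_cst|exact: exprn_continuous].
Qed.

Lemma measurable_poisson t : 0 < t -> measurable_fun setT (poisson t).
Proof. by move=> t0; apply: continuous_measurable_fun; exact: continuous_poisson. Qed.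

Lemma poissonN t u : poisson t (- u) = poisson t u.
Proof. by rewrite /poisson sqrrN. Qed.

Lemma continuous_mulr_comp (f : R -> R) u : continuous f ->
  continuous (fun z => f (u * z)).
Proof.
move=> cf z; apply: (@continuous_comp _ _ _ ( *%R u) f); last exact: cf.
by apply: cvgM; [exact: cvg_cst|exact: cvg_id].
Qed.

Lemma is_derive_mulr (k x : R) : is_derive x 1 ( *%R k) k.
Proof.
have := is_deriveZ k (@is_derive_id _ R^o x 1).
by rewrite /GRing.scale/= mulr1.
Qed.

Lemma continuous_exp_abs t : continuous (fun z => expR (- (t * `|z|))).
Proof.
move=> z; apply: (@continuous_comp _ _ _ (fun z => - (t * `|z|)) expR).
  by apply: cvgN; apply: cvgM; [exact: cvg_cst|exact: norm_continuous].
exact: continuous_expR.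
Qed.

Lemma measurable_exp_abs t : measurable_fun setT (fun z => expR (- (t * `|z|))).
Proof. by apply: continuous_measurable_fun; exact: continuous_exp_abs. Qed.

Lemma measurable_cosM u : measurable_fun setT (fun z => cos (u * z)).
Proof.
apply: continuous_measurable_fun.
exact: (@continuous_mulr_comp _ u (@continuous_cos R)).
Qed.

(** Adding 1 to the cosine makes the integrand nonnegative, so that the
    fundamental theorem of calculus applies on an unbounded interval. The
    primitive is an explicit combination of exp (- t z) with its products by
    cos (u z) and sin (u z). *)
Lemma integral0y_exp_1cos t u : 0 < t ->
  (\int[leb]_(z in `[0%R, +oo[) (expR (- (t * z)) * (1 + cos (u * z)))%:E =
   (t^-1 + t / (t ^+ 2 + u ^+ 2))%:E)%E.
Proof.
move=> t0; have D0 : t ^+ 2 + u ^+ 2 != 0 by rewrite gt_eqF// poisson_den_gt0.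
pose a := - t^-1; pose b := u / (t ^+ 2 + u ^+ 2).
pose c := - (t / (t ^+ 2 + u ^+ 2)).
pose F z := expR (- (t * z)) * (a + b * sin (u * z) + c * cos (u * z)).
have dF z : is_derive z 1 F (expR (- (t * z)) * (1 + cos (u * z))).
  have dl k : is_derive z 1 ( *%R k) k := is_derive_mulr k z.
  have de : is_derive z 1 (expR \o *%R (- t)) (expR (- t * z) * - t).
    exact: is_derive1_comp.
  have ds : is_derive z 1 (sin \o *%R u) (cos (u * z) * u).
    exact: is_derive1_comp.
  have dc : is_derive z 1 (cos \o *%R u) (- sin (u * z) * u).
    exact: is_derive1_comp.
  have := is_deriveM de (is_deriveD (is_deriveD (@is_derive_cst _ R^o R^o a z 1)
    (is_deriveZ b ds)) (is_deriveZ c dc)).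
  have -> : (expR \o *%R (- t)) * (cst a + b *: (sin \o *%R u) + c *: (cos \o *%R u))
    = F by apply/funext => x; rewrite /F /= -mulNr.
  move=> dF; apply: (is_derive_eq dF).
  rewrite /GRing.scale/= add0r mulNr.
  have -> : (cst a + b \*: (sin \o *%R u) + c \*: (cos \o *%R u)) z =
    a + b * sin (u * z) + c * cos (u * z) by [].
  rewrite /a /b /c; field.
  by rewrite D0 gt_eqF.
have cf : continuous (fun z => expR (- (t * z)) * (1 + cos (u * z))).
  under eq_fun do rewrite -mulNr.
  move=> z; apply: cvgM.
    exact: (@continuous_mulr_comp _ (- t) (@continuous_expR R)).
  apply: cvgD; first exact: cvg_cst.
  exact: (@continuous_mulr_comp _ u (@continuous_cos R)).
rewrite (@ge0_continuous_FTC2y _ _ F 0 0).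
- by rewrite -EFinB /F !mulr0 oppr0 expR0 sin0 cos0; congr EFin; rewrite /a /c; ring.
- by move=> x _; rewrite mulr_ge0 ?expR_ge0// -lerBlDl sub0r cos_geN1.
- exact: continuous_subspaceT.
- pose M := `|a| + `|b| + `|c|.
  have e0 : M * expR (- (t * z)) @[z --> +oo] --> 0.
    rewrite -[X in _ --> X](mulr0 M); apply: cvgMl_tmp.
    apply: (@cvg_comp _ _ _ ( *%R t) (fun z => expR (- z))); last exact: cvgr_expR.
    exact: gt0_cvgMry.
  apply: (@squeeze_cvgr _ _ _ _ (fun z => - (M * expR (- (t * z))))
     (fun z => M * expR (- (t * z)))); last exact: e0; last first.
    by rewrite -oppr0; exact: cvgN e0.
  apply: nearW => z; rewrite -ler_norml normrM [leLHS]mulrC [`|expR _|]ger0_norm ?expR_ge0//.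
  rewrite ler_wpM2r ?expR_ge0// /M.
  rewrite (le_trans (ler_normD _ _))// lerD//.
    rewrite (le_trans (ler_normD _ _))// lerD// normrM ler_piMr//.
    by rewrite ler_norml sin_geN1 sin_le1.
  by rewrite normrM ler_piMr// cos_max.
- by move=> z _; exact: ex_derive.
- apply: cvg_at_right_filter; apply: differentiable_continuous.
  by apply/derivable1_diffP; exact: ex_derive.
- by move=> z _; rewrite derive1E; exact: derive_val.
Qed.

Lemma integral_exp_1cos t u : 0 < t ->
  (\int[leb]_z (expR (- (t * `|z|)) * (1 + cos (u * z)))%:E =
   (2 / t + poisson t u)%:E)%E.
Proof.
move=> t0; rewrite ge0_symfun_integralT.
- rewrite -set_itvcy// (_ : (2 / t + poisson t u) =
    2 * (t^-1 + t / (t ^+ 2 + u ^+ 2))); last by rewrite /poisson; ring.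
  rewrite EFinM -integral0y_exp_1cos//; congr (_ * _)%E.
  apply: eq_integral => z; rewrite inE/= in_itv/= andbT => z0.
  by rewrite ger0_norm.
- by move=> x; rewrite mulr_ge0 ?expR_ge0// -lerBlDl sub0r cos_geN1.
- move=> z; apply: cvgM; first exact: continuous_exp_abs.
  apply: cvgD; first exact: cvg_cst.
  exact: (@continuous_mulr_comp _ u (@continuous_cos R)).
- by move=> z /=; rewrite normrN mulrN cosN.
Qed.

Lemma integrable_exp_abs t : 0 < t ->
  leb.-integrable setT (fun z => (expR (- (t * `|z|)))%:E).
Proof.
move=> t0; apply/integrableP; split.
  by apply/measurable_EFinP; exact: measurable_exp_abs.
have := integral_exp_1cos 0 t0.
under eq_integral do rewrite mul0r cos0.
move=> E; apply: le_lt_trans (_ : ((2 / t + poisson t 0)%:E < +oo)%E); last exact: ltry.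
rewrite -E; apply: ge0_le_lower_integral => // z.
rewrite gee0_abs ?lee_fin ?expR_ge0// ler_pMr ?expR_gt0//.
by rewrite lerDl.
Qed.

Lemma integrable_exp_cos t u : 0 < t ->
  leb.-integrable setT (fun z => (expR (- (t * `|z|)) * cos (u * z))%:E).
Proof.
move=> t0; apply: le_integrable (integrable_exp_abs t0) => //.
  apply/measurable_EFinP; apply: measurable_funM; first exact: measurable_exp_abs.
  exact: measurable_cosM.
move=> z _; rewrite /= lee_fin normrM ler_piMr ?cos_max//.
Qed.

(** The value at u = 0 of the preceding integral gives that of exp (- t |z|),
    which is then subtracted. *)
Lemma Rintegral_exp_cos t u : 0 < t ->
  \int[leb]_z (expR (- (t * `|z|)) * cos (u * z)) = poisson t u.
Proof.
move=> t0; have ie := integrable_exp_abs t0.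
have E v : \int[leb]_z expR (- (t * `|z|)) +
    \int[leb]_z (expR (- (t * `|z|)) * cos (v * z)) = 2 / t + poisson t v.
  rewrite -RintegralD//; last exact: integrable_exp_cos.
  have := congr1 fine (integral_exp_1cos v t0); rewrite /= => <-.
  by apply: eq_Rintegral => z _; rewrite mulrDr mulr1.
have E0 : \int[leb]_z expR (- (t * `|z|)) = 2 / t.
  have := E 0; under [X in _ + X]eq_Rintegral do rewrite mul0r cos0 mulr1.
  have -> : poisson t 0 = 2 / t by rewrite /poisson; field; rewrite gt_eqF.
  by move=> E0; lra.
by have := E u; rewrite E0 => /addrI.
Qed.

(** By scaling this is twice the integral of 1 / (1 + x^2). *)
Lemma integral_poisson t c : 0 < t ->
  (\int[leb]_x (poisson t (x - c))%:E = (2 * pi)%:E)%E.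
Proof.
move=> t0; rewrite -(ge0_integral_affine c t0); last 2 first.
- apply/measurable_EFinP; apply: measurableT_comp; first exact: measurable_poisson.
  exact: measurable_funD.
- by move=> x; rewrite lee_fin poisson_ge0.
rewrite -ge0_integralZl//; last 3 first.
- apply/measurable_EFinP; apply: measurableT_comp; first exact: measurable_poisson.
  by under eq_fun do rewrite addrK; exact: measurable_funM.
- by move=> x; rewrite lee_fin poisson_ge0.
- by rewrite lee_fin ltW.
transitivity (\int[leb]_x (2 * (oneDsqr (x : R))^-1)%:E)%E.
  apply: eq_integral => x _; rewrite -EFinM addrK /poisson /oneDsqr.
  have x0 : 1 + x ^+ 2 != 0 by rewrite gt_eqF// ltr_pwDl// sqr_ge0.
  have t1 : t != 0 by rewrite gt_eqF.
  have -> : t ^+ 2 + (t * x) ^+ 2 = t ^+ 2 * (1 + x ^+ 2) by ring.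
  by congr EFin; field; rewrite t1 x0.
rewrite ge0_symfun_integralT.
- rewrite -set_itvcy//.
  under eq_integral do rewrite EFinM.
  rewrite ge0_integralZl//.
  + rewrite integral0y_oneDsqr -!EFinM; congr EFin; by field.
  + apply/measurable_EFinP; apply: measurable_funTS.
    apply: (@continuous_measurable_fun _ (fun x : R => (oneDsqr x)^-1)).
    exact: (@continuous_oneDsqrV R).
- by move=> x; rewrite mulr_ge0// invr_ge0.
- by move=> x; apply: cvgM; [exact: cvg_cst|exact: (@continuous_oneDsqrV R)].
- by move=> x; rewrite /= /oneDsqr sqrrN.
Qed.

End Poisson.

(** * Cosine and sine transforms *)

Section TrigTransform.
Context (R : realType).
Implicit Types (f g : R -> R) (b : bool) (t x y z : R).

(** Sine for true and cosine for false: the boolean makes one proof serve both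
    transforms. *)
Definition trig b x := if b then sin x else cos x.

(** The real part (false) and the imaginary part (true) of the Fourier
    transform of a real function. *)
Definition trig_transform b f z := \int[leb]_x (f x * trig b (z * x)).

Lemma trig_le1 b x : `|trig b x| <= 1.
Proof. by case: b; rewrite ?cos_max// ler_norml sin_geN1 sin_le1. Qed.

Lemma continuous_trig b : continuous (trig b).
Proof. by case: b; [exact: continuous_sin|exact: continuous_cos]. Qed.

Lemma measurable_trig b : measurable_fun setT (trig b).
Proof. by apply: continuous_measurable_fun; exact: continuous_trig. Qed.

Lemma trigM b x y :
  trig b x * trig b y = (cos (x - y) + (-1) ^+ b * cos (x + y)) / 2.
Proof. by case: b; rewrite /= cosB cosD; field. Qed.

Lemma integrable_mul_le1 f g : leb.-integrable setT (EFin \o f) ->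
  measurable_fun setT g -> (forall x, `|g x| <= 1) ->
  leb.-integrable setT (fun x => (f x * g x)%:E).
Proof.
move=> intf mg g1; have [mf _] := integrableP _ _ _ intf.
apply: le_integrable intf => //.
  by apply/measurable_EFinP; apply: measurable_funM => //; exact/measurable_EFinP.
by move=> x _; rewrite /= lee_fin normrM ler_piMr.
Qed.

Lemma integrable_trig b f z : leb.-integrable setT (EFin \o f) ->
  leb.-integrable setT (fun x => (f x * trig b (z * x))%:E).
Proof.
move=> intf; apply: integrable_mul_le1 => // [|x]; last exact: trig_le1.
by apply: measurableT_comp; [exact: measurable_trig|exact: measurable_funM].
Qed.

Lemma trig_transform_le b f z : leb.-integrable setT (EFin \o f) ->
  `|trig_transform b f z| <= \int[leb]_x `|f x|.
Proof.
move=> intf; apply: le_trans (le_normr_Rintegral _ (integrable_trig b z intf)) _ => //.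
apply: le_Rintegral => //.
- exact: integrable_abse (integrable_trig b z intf).
- exact: integrable_abse intf.
- by move=> x _; rewrite normrM ler_piMr// trig_le1.
Qed.

Lemma measurable_trig_transform b f : measurable_fun setT f ->
  measurable_fun setT (trig_transform b f).
Proof.
move=> mf.
pose h (q : measurableTypeR R * measurableTypeR R) := f q.2 * trig b (q.1 * q.2).
apply: (@measurable_Rintegral_param _ _ (measurableTypeR R) (measurableTypeR R) R leb h).
apply: measurable_funM; first exact: measurableT_comp.
by apply: measurableT_comp; [exact: measurable_trig|exact: measurable_funM].
Qed.

(** Fubini's theorem for the product of two integrable functions and a bounded
    kernel; every exchange of integrals in the proofs of Bessel's inequality
    and of the inversion formula has this form. *)
Lemma Rintegral_exchange f g (k : R * R -> R) :
  leb.-integrable setT (EFin \o f) -> leb.-integrable setT (EFin \o g) ->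
  measurable_fun setT k -> (forall q, `|k q| <= 1) ->
  \int[leb]_x (f x * \int[leb]_z (g z * k (x, z))) =
  \int[leb]_z (g z * \int[leb]_x (f x * k (x, z))).
Proof.
move=> intf intg mk k1.
have [/measurable_EFinP mf foo] := integrableP _ _ _ intf.
have [/measurable_EFinP mg goo] := integrableP _ _ _ intg.
have mkl x : measurable_fun setT (fun z => k (x, z)).
  by apply: measurableT_comp => //; exact: measurable_pair1.
have mkr z : measurable_fun setT (fun x => k (x, z)).
  by apply: measurableT_comp => //; exact: measurable_pair2.
pose h (q : measurableTypeR R * measurableTypeR R) := f q.1 * (g q.2 * k q).
have ig x : leb.-integrable setT (fun z => (g z * k (x, z))%:E).
  exact: integrable_mul_le1.
have ifk z : leb.-integrable setT (fun x => (f x * k (x, z))%:E).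
  exact: integrable_mul_le1.
transitivity (\int[leb]_x (\int[leb]_z h (x, z))).
  by apply: eq_Rintegral => x _; rewrite -RintegralZl//; exact: ig.
transitivity (\int[leb]_z (\int[leb]_x h (x, z))); last first.
  apply: eq_Rintegral => z _; rewrite -RintegralZl//; last exact: ifk.
  by apply: eq_Rintegral => x _; rewrite /h /=; ring.
apply: Rfubini.
- apply: measurable_funM; first exact: measurableT_comp.
  by apply: measurable_funM => //; exact: measurableT_comp.
- apply: (@le_lt_trans _ _ (\int[leb]_x `|(f x)%:E| * \int[leb]_x `|(g x)%:E|)%E).
    rewrite -ge0_integralZr//; last first.
    + exact: integral_ge0.
    + by apply: measurableT_comp => //; exact/measurable_EFinP.
    apply: ge0_le_lower_integral => x; first exact: integral_ge0.
    rewrite -ge0_integralZl//; last first.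
      by apply: measurableT_comp => //; exact/measurable_EFinP.
    apply: ge0_le_lower_integral => z //.
    rewrite -EFinM lee_fin !normrM ler_wpM2l// ler_piMr//.
  by rewrite lte_mul_pinfty//; [exact: integral_ge0|rewrite ge0_fin_numE//; exact: integral_ge0].
- by move=> x; apply: (integrableZl _ (f x) (ig x)).
- move=> z; have := integrableZl measurableT (g z) (ifk z).
  apply: eq_integrable => // x _; rewrite /h /= -EFinM; congr EFin; ring.
Qed.

End TrigTransform.

(** * Bessel's inequality *)

Section PoissonForm.
Context (R : realType).
Implicit Types (f g : R -> R) (b : bool) (t x y z : R).

(** The cosine case of the kernel that Abel summation produces; it dominates
    the sine case in absolute value. *)
Definition poisson_form t (q : R * R) : R :=
  (poisson t (q.1 - q.2) + poisson t (q.1 + q.2)) / 2.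

Lemma poisson_form_ge0 t q : 0 < t -> 0 <= poisson_form t q.
Proof. by move=> t0; rewrite divr_ge0// addr_ge0// poisson_ge0. Qed.

Lemma poisson_formC t x y : poisson_form t (x, y) = poisson_form t (y, x).
Proof. by rewrite /poisson_form/= -opprB poissonN [y + x]addrC. Qed.

Lemma measurable_poisson_form t : 0 < t -> measurable_fun setT (poisson_form t).
Proof.
move=> t0; apply: measurable_funM => //; apply: measurable_funD.
  by apply: measurableT_comp; [exact: measurable_poisson|exact: measurable_funB].
by apply: measurableT_comp; [exact: measurable_poisson|exact: measurable_funD].
Qed.

Lemma integral_poisson_form t x : 0 < t ->
  (\int[leb]_y (poisson_form t (x, y))%:E = (2 * pi)%:E)%E.
Proof.
move=> t0.
have mp c : measurable_fun [set: measurableTypeR R]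
    (fun y : measurableTypeR R => (poisson t (y - c))%:E).
  apply/measurable_EFinP; apply: measurableT_comp; first exact: measurable_poisson.
  exact: measurable_funD.
transitivity (\int[leb]_y ((2^-1)%:E * ((poisson t (y - x))%:E +
    (poisson t (y - - x))%:E)))%E.
  apply: eq_integral => y _; rewrite -EFinD -EFinM /poisson_form/= -opprB poissonN.
  by rewrite opprK [y + x]addrC mulrC.
rewrite ge0_integralZl//; last 2 first.
- by apply: emeasurable_funD; exact: mp.
- by move=> z _; rewrite -EFinD lee_fin addr_ge0// poisson_ge0.
rewrite ge0_integralD//.
- by rewrite !integral_poisson// -EFinD -EFinM; congr EFin; field.
- by move=> z _; rewrite lee_fin poisson_ge0.
- by move=> z _; rewrite lee_fin poisson_ge0.
Qed.

Lemma normM_le_halfsqr (a b p : R) : 0 <= p ->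
  `|a| * (`|b| * p) <= a ^+ 2 * (2^-1 * p) + b ^+ 2 * (2^-1 * p).
Proof.
move=> p0; rewrite !mulrA -mulrDl ler_wpM2r// -mulrDl.
rewrite -(real_normK (num_real a)) -(real_normK (num_real b)).
by have := sqr_ge0 (`|a| - `|b|); rewrite sqrrB; lra.
Qed.

(** By |f(x) f(y)| <= (f(x)^2 + f(y)^2) / 2 and the symmetry of the kernel,
    only its integral 2 pi in one variable matters (Schur's test). *)
Lemma poisson_form_le t f : 0 < t -> measurable_fun setT f ->
  (\int[leb]_x \int[leb]_y (`|f x| * (`|f y| * poisson_form t (x, y)))%:E <=
   (2 * pi)%:E * \int[leb]_x (f x ^+ 2)%:E)%E.
Proof.
move=> t0 mf.
have mp x : measurable_fun [set: measurableTypeR R]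
    (fun y : measurableTypeR R => (poisson_form t (x, y))%:E).
  apply/measurable_EFinP; apply: measurableT_comp; first exact: measurable_poisson_form.
  exact: measurable_pair1.
have mf2 : measurable_fun [set: measurableTypeR R]
    (fun x : measurableTypeR R => (f x ^+ 2)%:E).
  by apply/measurable_EFinP; exact: measurable_funX.
pose h (q : measurableTypeR R * measurableTypeR R) : \bar R :=
  ((f q.1 ^+ 2)%:E * (2^-1 * poisson_form t q)%:E)%E.
pose h' (q : measurableTypeR R * measurableTypeR R) : \bar R :=
  ((f q.2 ^+ 2)%:E * (2^-1 * poisson_form t q)%:E)%E.
have mp2 : measurable_fun setT (fun q => (2^-1 * poisson_form t q)%:E).
  apply/measurable_EFinP; apply: measurable_funM => //.
  exact: measurable_poisson_form.
have mh : measurable_fun setT h.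
  by apply: emeasurable_funM => //; exact: (measurableT_comp mf2).
have mh' : measurable_fun setT h'.
  by apply: emeasurable_funM => //; exact: (measurableT_comp mf2).
have h0 q : (0 <= h q)%E.
  by rewrite mule_ge0// lee_fin ?sqr_ge0// mulr_ge0// poisson_form_ge0.
have h'0 q : (0 <= h' q)%E.
  by rewrite mule_ge0// lee_fin ?sqr_ge0// mulr_ge0// poisson_form_ge0.
have Eh : (\int[leb]_x \int[leb]_y h (x, y) = pi%:E * \int[leb]_x (f x ^+ 2)%:E)%E.
  transitivity (\int[leb]_x (pi%:E * (f x ^+ 2)%:E))%E.
    apply: eq_integral => x _; rewrite /h /=.
    under eq_integral do rewrite (EFinM 2^-1) muleA.
    rewrite ge0_integralZl//; last 2 first.
    - by move=> y _; rewrite lee_fin poisson_form_ge0.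
    - by rewrite mule_ge0// lee_fin ?sqr_ge0.
    by rewrite integral_poisson_form// -!EFinM; congr EFin; field.
  rewrite ge0_integralZl//.
  - by move=> x _; rewrite lee_fin sqr_ge0.
  - by rewrite lee_fin pi_ge0.
have Eh' : (\int[leb]_x \int[leb]_y h' (x, y) =
    \int[leb]_x \int[leb]_y h (x, y))%E.
  transitivity (\int[leb]_y \int[leb]_x h' (x, y))%E.
    exact: (@fubini_tonelli _ _ _ _ R leb leb h' mh' h'0).
  apply: eq_integral => x _; apply: eq_integral => y _.
  by rewrite /h /h' /= poisson_formC.
have mF := measurable_fun_fubini_tonelli_F (m2 := leb) h mh h0.
have mF' := measurable_fun_fubini_tonelli_F (m2 := leb) h' mh' h'0.
apply: (@le_trans _ _ (\int[leb]_x (\int[leb]_y h (x, y) + \int[leb]_y h' (x, y)))%E).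
  apply: ge0_le_lower_integral => x.
    by apply: integral_ge0 => y _; rewrite lee_fin mulr_ge0 ?normr_ge0// mulr_ge0 ?normr_ge0 ?poisson_form_ge0.
  have mhx : measurable_fun [set: measurableTypeR R] (fun y => h (x, y)).
    by apply: measurableT_comp => //; exact: measurable_pair1.
  have mh'x : measurable_fun [set: measurableTypeR R] (fun y => h' (x, y)).
    by apply: measurableT_comp => //; exact: measurable_pair1.
  rewrite -(ge0_integralD leb measurableT (fun y _ => h0 (x, y)) mhx
    (fun y _ => h'0 (x, y)) mh'x).
  apply: ge0_le_lower_integral => y.
    by rewrite lee_fin mulr_ge0 ?normr_ge0// mulr_ge0 ?normr_ge0 ?poisson_form_ge0.
  rewrite /h /h' -!EFinM -EFinD lee_fin; apply: normM_le_halfsqr.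
  exact: poisson_form_ge0.
rewrite ge0_integralD//; last 2 first.
- by move=> x _; exact: integral_ge0.
- by move=> x _; exact: integral_ge0.
rewrite Eh' Eh -ge0_muleDl ?lee_fin ?pi_ge0// -EFinD.
by rewrite mulr_natl mulr2n.
Qed.

End PoissonForm.

Section Bessel.
Context (R : realType).
Implicit Types (f g : R -> R) (b : bool) (t x y z : R).

Lemma measurable_trig2 b :
  measurable_fun setT (fun q : measurableTypeR R * measurableTypeR R => trig b (q.2 * q.1)).
Proof.
by apply: measurableT_comp; [exact: measurable_trig|exact: measurable_funM].
Qed.

(** The product-to-sum formula reduces this to the transform of exp (- t |z|).
    *)
Lemma Rintegral_exp_trigM b t x y : 0 < t ->
  \int[leb]_z (expR (- (t * `|z|)) * trig b (z * x) * trig b (z * y)) =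
  (poisson t (x - y) + (-1) ^+ b * poisson t (x + y)) / 2.
Proof.
move=> t0.
transitivity (\int[leb]_z ((expR (- (t * `|z|)) * cos ((x - y) * z)) * 2^-1 +
    (expR (- (t * `|z|)) * cos ((x + y) * z)) * ((-1) ^+ b * 2^-1))).
  apply: eq_Rintegral => z _; rewrite -mulrA trigM.
  by rewrite -mulrBr -mulrDr !(mulrC z); field.
have ie v := integrable_exp_cos v t0.
rewrite RintegralD//; last 2 first.
- exact: (integrableZr _ _ (ie (x - y))).
- exact: (integrableZr _ _ (ie (x + y))).
rewrite !RintegralZr//; last 2 first.
- exact: ie.
- exact: ie.
by rewrite !Rintegral_exp_cos//; field.
Qed.

(** Both sides come from the triple integral of f(x) f(y) exp (- t |z|) trig
    (z x) trig (z y); the weight makes it absolutely convergent. *)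
Lemma abel_plancherel b f t : 0 < t -> leb.-integrable setT (EFin \o f) ->
  \int[leb]_z (trig_transform b f z * expR (- (t * `|z|)) * trig_transform b f z) =
  \int[leb]_x (f x * \int[leb]_y (f y *
    ((poisson t (x - y) + (-1) ^+ b * poisson t (x + y)) / 2))).
Proof.
move=> t0 intf; have [/measurable_EFinP mf _] := integrableP _ _ _ intf.
pose g z := trig_transform b f z * expR (- (t * `|z|)).
have intg : leb.-integrable setT (EFin \o g).
  have ie := integrableZl measurableT (\int[leb]_x `|f x|) (integrable_exp_abs t0).
  apply: le_integrable ie => //.
    apply/measurable_EFinP; apply: measurable_funM.
      exact: measurable_trig_transform.
    exact: measurable_exp_abs.
  move=> z _; rewrite /= lee_fin !normrM ler_wpM2r//.
  rewrite (le_trans (trig_transform_le b z intf))//.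
  by rewrite ger0_norm// Rintegral_ge0.
have mk := measurable_trig2 b.
have := Rintegral_exchange intf intg mk (fun=> trig_le1 b _).
rewrite /= => /esym E.
rewrite [LHS]E; apply: eq_Rintegral => x _; congr (_ * _).
have inte : leb.-integrable setT (EFin \o (fun z => expR (- (t * `|z|)) * trig b (z * x))).
  apply: integrable_mul_le1; first exact: integrable_exp_abs.
    by apply: measurableT_comp; [exact: measurable_trig|exact: measurable_funM].
  by move=> z; exact: trig_le1.
have := Rintegral_exchange intf inte mk (fun=> trig_le1 b _).
rewrite /= => E'.
transitivity (\int[leb]_z (expR (- (t * `|z|)) * trig b (z * x) *
    \int[leb]_y (f y * trig b (z * y)))).
  by apply: eq_Rintegral => z _; rewrite /g /trig_transform; ring.
rewrite -E'; apply: eq_Rintegral => y _; congr (_ * _).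
exact: Rintegral_exp_trigM.
Qed.

Lemma bessel_abel b f t : 0 < t -> leb.-integrable setT (EFin \o f) ->
  (\int[leb]_z (trig_transform b f z ^+ 2 * expR (- (t * `|z|)))%:E <=
   (2 * pi)%:E * \int[leb]_x (f x ^+ 2)%:E)%E.
Proof.
move=> t0 intf; have [/measurable_EFinP mf _] := integrableP _ _ _ intf.
have mT := measurable_trig_transform b mf.
have intg : leb.-integrable setT
    (fun z => (trig_transform b f z * expR (- (t * `|z|)) * trig_transform b f z)%:E).
  have ie := integrableZl measurableT ((\int[leb]_x `|f x|) ^+ 2) (integrable_exp_abs t0).
  apply: le_integrable ie => //.
    apply/measurable_EFinP; apply: measurable_funM => //.
    by apply: measurable_funM => //; exact: measurable_exp_abs.
  move=> z _; rewrite /= lee_fin !normrM mulrAC ler_wpM2r// -expr2.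
  rewrite -expr2 ler_sqr ?nnegrE// [leRHS]ger0_norm ?Rintegral_ge0//.
  exact: trig_transform_le.
rewrite (_ : \int[leb]_z _ = (\int[leb]_z
    (trig_transform b f z * expR (- (t * `|z|)) * trig_transform b f z))%:E)%E; last first.
  rewrite fineK; last exact: integrable_fin_num intg.
  by apply: eq_integral => z _; congr EFin; ring.
rewrite abel_plancherel//.
apply: le_trans (poisson_form_le t0 mf).
pose q x y := (poisson t (x - y) + (-1) ^+ b * poisson t (x + y)) / 2.
have mq x : measurable_fun [set: measurableTypeR R] (q x).
  apply: measurable_funM => //; apply: measurable_funD; last apply: measurable_funM => //.
    by apply: measurableT_comp; [exact: measurable_poisson|exact: measurable_funB].
  by apply: measurableT_comp; [exact: measurable_poisson|exact: measurable_funD].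
have qle x y : `|q x y| <= poisson_form t (x, y).
  rewrite /q /poisson_form normrM [`|2^-1|]ger0_norm// ler_wpM2r//.
  rewrite (le_trans (ler_normD _ _))// normrMsign.
  by rewrite !ger0_norm ?poisson_ge0.
pose r := \int[leb]_x (f x * \int[leb]_y (f y * q x y)).
have [r0|r0] := leP r 0.
  apply: (@le_trans _ _ 0%E); first by rewrite lee_fin.
  apply: integral_ge0 => x _; apply: integral_ge0 => y _.
  by rewrite lee_fin mulr_ge0 ?normr_ge0// mulr_ge0 ?normr_ge0 ?poisson_form_ge0.
apply: (@le_trans _ _ (\int[leb]_x (f x * \int[leb]_y (f y * q x y))%:E)%E).
  rewrite /r /Rintegral; move: r0; rewrite /r [X in 0 < X]/Rintegral.
  by case: (X in 0 < fine X) => [s _|_|]; rewrite ?leey//= ltxx.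
apply: (@le_trans _ _ (\int[leb]_x `|(f x * \int[leb]_y (f y * q x y))%:E|)%E).
  apply: (le_trans (lee_abs _)); apply: le_abse_integral => //.
  apply/measurable_EFinP; apply: measurable_funM => //.
  pose h (p : measurableTypeR R * measurableTypeR R) := f p.2 * q p.1 p.2.
  apply: (@measurable_Rintegral_param _ _ (measurableTypeR R) (measurableTypeR R) R leb h).
  apply: measurable_funM; first exact: measurableT_comp.
  apply: measurable_funM => //; apply: measurable_funD; last apply: measurable_funM => //.
    by apply: measurableT_comp; [exact: measurable_poisson|exact: measurable_funB].
  by apply: measurableT_comp; [exact: measurable_poisson|exact: measurable_funD].
apply: ge0_le_lower_integral => // x.
rewrite abse_EFin normrM EFinM.
apply: (@le_trans _ _ (`|f x|%:E * \int[leb]_y (`|f y| * poisson_form t (x, y))%:E)%E).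
  apply: lee_pmul => //; rewrite ?lee_fin//.
  apply: (@le_trans _ _ (\int[leb]_y `|(f y * q x y)%:E|)%E); last first.
    apply: ge0_le_lower_integral => // y.
    by rewrite abse_EFin lee_fin normrM ler_wpM2l.
  apply: le_trans; last first.
    apply: le_abse_integral => //; apply/measurable_EFinP.
    exact: measurable_funM.
  rewrite /Rintegral; case: (\int[leb]_y _)%E => [s||] //=; by rewrite ?normr0 ?leey.
rewrite -ge0_integralZl//.
- by apply/measurable_EFinP; apply: measurable_funM; [exact: measurableT_comp|
    apply: measurableT_comp; [exact: measurable_poisson_form|exact: measurable_pair1]].
- by move=> y _; rewrite lee_fin mulr_ge0 ?normr_ge0 ?poisson_form_ge0.
Qed.

(** One inequality of Plancherel's theorem, for each component of the
    transform. Its Abel means satisfy it, and Fatou's lemma lets the weight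
    exp (- t |z|) tend to 1. *)
Lemma bessel b f : leb.-integrable setT (EFin \o f) ->
  (\int[leb]_z (trig_transform b f z ^+ 2)%:E <=
   (2 * pi)%:E * \int[leb]_x (f x ^+ 2)%:E)%E.
Proof.
move=> intf; have [/measurable_EFinP mf _] := integrableP _ _ _ intf.
have mT := measurable_trig_transform b mf.
pose f_ (n : nat) z := (trig_transform b f z ^+ 2 * expR (- (n.+1%:R^-1 * `|z|)))%:E.
apply: (@fatou_bound _ (measurableTypeR R) R leb f_ _
  (fun=> (2 * pi)%:E * \int[leb]_x (f x ^+ 2)%:E)%E).
- move=> n; apply/measurable_EFinP; apply: measurable_funM.
    exact: measurable_funX.
  exact: measurable_exp_abs.
- by move=> n z; rewrite lee_fin mulr_ge0 ?sqr_ge0 ?expR_ge0.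
- move=> z; apply: cvg_EFin; first exact: nearW.
  rewrite -[X in _ --> X]mulr1 -expR0; apply: cvgM; first exact: cvg_cst.
  apply: (@cvg_comp _ _ _ (fun n : nat => - (n.+1%:R^-1 * `|z|)) expR _ (nbhs (0 : R))).
    rewrite -oppr0 -(mul0r `|z|); apply: cvgN; apply: cvgM; last exact: cvg_cst.
    exact: cvg_harmonic.
  exact: continuous_expR.
- by move=> n; exact: bessel_abel.
- exact: cvg_cst.
Qed.

End Bessel.

(** * Fourier inversion *)

Section RDominated.
Context d (T : measurableType d) (R : realType).
Variable mu : {measure set T -> \bar R}.

Lemma Rdominated_cvg (f_ : nat -> T -> R) (f g : T -> R) :
  (forall n, measurable_fun setT (f_ n)) ->
  (forall x, f_ ^~ x @ \oo --> f x) -> mu.-integrable setT (EFin \o g) ->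
  (forall n x, `|f_ n x| <= g x) ->
  (fun n => \int[mu]_x f_ n x) @ \oo --> \int[mu]_x f x.
Proof.
move=> mf fcvg intg fg.
have mf' n : measurable_fun setT (EFin \o f_ n) by exact/measurable_EFinP.
have fcvg' x : setT x -> (EFin \o f_ n) x @[n --> \oo] --> (EFin \o f) x.
  by move=> _; apply: cvg_EFin; [exact: nearW|exact: fcvg].
have fg' n x : setT x -> (`|(EFin \o f_ n) x| <= (EFin \o g) x)%E.
  by move=> _; rewrite /= lee_fin.
have mlim : measurable_fun setT (EFin \o f).
  exact: (emeasurable_fun_cvg _ _ mf' fcvg').
have [intf _ lim] := dominated_convergence measurableT mf' mlim
  (aeW _ fcvg') intg (aeW _ (fun x n Tx => fg' n x Tx)).
move: lim; rewrite /Rintegral -[X in _ --> X]fineK; last exact: integrable_fin_num intf.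
exact: fine_cvg.
Qed.

End RDominated.

Section Inversion.
Context (R : realType).
Implicit Types (f g : R -> R) (b : bool) (t x y z : R).

Lemma integrable_poisson t y : 0 < t ->
  leb.-integrable setT (fun x => (poisson t (x - y))%:E).
Proof.
move=> t0; apply/integrableP; split.
  apply/measurable_EFinP; apply: measurableT_comp; first exact: measurable_poisson.
  exact: measurable_funD.
under eq_integral do rewrite abse_EFin ger0_norm ?poisson_ge0//.
by rewrite integral_poisson// ltry.
Qed.

Lemma integrable_poisson0 t : 0 < t ->
  leb.-integrable setT (fun x => (poisson t x)%:E).
Proof.
move=> t0; have := integrable_poisson 0 t0.
by apply: eq_integrable => // x _; rewrite subr0.
Qed.

(** The real part of exp (- i z y) times the Fourier transform of f at z. *)
Definition inversion_integrand f y z :=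
  cos (z * y) * trig_transform false f z + sin (z * y) * trig_transform true f z.

Lemma inversion_integrandE f y z : leb.-integrable setT (EFin \o f) ->
  inversion_integrand f y z = \int[leb]_x (f x * cos ((x - y) * z)).
Proof.
move=> intf.
have ic := integrable_trig false z intf; have is' := integrable_trig true z intf.
rewrite /inversion_integrand /trig_transform -!RintegralZl//.
rewrite -RintegralD//; last 2 first.
- exact: (integrableZl _ _ ic).
- exact: (integrableZl _ _ is').
by apply: eq_Rintegral => x _; rewrite mulrBl cosB /= !(mulrC z); ring.
Qed.

(** The Abel means of the inversion integral are the Poisson averages of f
    around y. *)
Lemma abel_inversion f y t : 0 < t -> leb.-integrable setT (EFin \o f) ->
  \int[leb]_z (expR (- (t * `|z|)) * inversion_integrand f y z) =
  \int[leb]_x (f x * poisson t (x - y)).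
Proof.
move=> t0 intf.
pose k (q : measurableTypeR R * measurableTypeR R) := cos ((q.1 - y) * q.2).
have mk : measurable_fun setT k.
  apply: measurableT_comp; first exact: (measurable_trig false).
  by apply: measurable_funM => //; exact: measurable_funB.
have := Rintegral_exchange intf (integrable_exp_abs t0) mk (fun=> cos_max _).
move=> E; transitivity (\int[leb]_z (expR (- (t * `|z|)) * \int[leb]_x (f x * k (x, z)))).
  by apply: eq_Rintegral => z _; rewrite inversion_integrandE.
rewrite -[LHS]E; apply: eq_Rintegral => x _; congr (_ * _).
by rewrite -(Rintegral_exp_cos (x - y) t0).
Qed.

(** The width t of the kernel is moved into the argument of f, which prepares
    the passage to the limit by dominated convergence. *)
Lemma poisson_rescaled f y t M : 0 < t -> measurable_fun setT f ->
  (forall x, `|f x| <= M) ->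
  \int[leb]_x (f x * poisson t (x - y)) =
  \int[leb]_v (f (t * v + y) * poisson 1 v).
Proof.
move=> t0 mf fM.
have intfp : leb.-integrable setT (EFin \o (fun x => f x * poisson t (x - y))).
  have ip := integrableZl measurableT M (integrable_poisson y t0).
  apply: le_integrable ip => //.
    apply/measurable_EFinP; apply: measurable_funM => //.
    apply: measurableT_comp; first exact: measurable_poisson.
    exact: measurable_funD.
  move=> x _; rewrite /= lee_fin [`|f x * _|]normrM [`|M * _|]normrM ler_wpM2r//.
  by rewrite (le_trans (fM x))// ler_norm.
have := Rintegral_affine y t0 intfp.
move=> /(congr1 ( *%R t)); rewrite mulrA divff ?gt_eqF// mul1r => <-.
rewrite -RintegralZl//; last exact: (integrable_affine y t0 intfp).
apply: eq_Rintegral => v _; rewrite addrK mulrCA; congr (_ * _).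
have t1 : t != 0 by rewrite gt_eqF.
have v0 : 1 + v ^+ 2 != 0 by rewrite gt_eqF// ltr_pwDl// sqr_ge0.
rewrite /poisson expr1n (_ : t ^+ 2 + (t * v) ^+ 2 = t ^+ 2 * (1 + v ^+ 2)); last ring.
by field; rewrite t1 v0.
Qed.

(** Both sides of Abel's identity converge as t tends to 0: the left side is
    dominated by the inversion integrand, the right one by a multiple of the
    Poisson kernel of width 1. *)
Lemma inversion f y M : continuous f -> (forall x, `|f x| <= M) ->
  leb.-integrable setT (EFin \o f) ->
  leb.-integrable setT (EFin \o inversion_integrand f y) ->
  \int[leb]_z inversion_integrand f y z = 2 * pi * f y.
Proof.
move=> cf fM intf intG; have mf := continuous_measurable_fun cf.
have [/measurable_EFinP mG _] := integrableP _ _ _ intG.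
pose t_ (n : nat) : R := n.+1%:R^-1.
have t0 n : 0 < t_ n by rewrite invr_gt0.
have lim1 : \int[leb]_z (expR (- (t_ n * `|z|)) * inversion_integrand f y z)
    @[n --> \oo] --> \int[leb]_z inversion_integrand f y z.
  apply: (@Rdominated_cvg _ (measurableTypeR R) R leb _ _
    (fun z => `|inversion_integrand f y z|)).
  - by move=> n; apply: measurable_funM => //; exact: measurable_exp_abs.
  - move=> z; rewrite -[X in _ --> X]mul1r -expR0; apply: cvgM; last exact: cvg_cst.
    apply: (@cvg_comp _ _ _ (fun n : nat => - (n.+1%:R^-1 * `|z|)) expR _ (nbhs (0 : R))).
      rewrite -oppr0 -(mul0r `|z|); apply: cvgN; apply: cvgM; last exact: cvg_cst.
      exact: cvg_harmonic.
    exact: continuous_expR.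
  - exact: integrable_abse intG.
  - move=> n z; rewrite normrM ler_piMl// ger0_norm ?expR_ge0//.
    by rewrite -expR0 ler_expR oppr_le0 mulr_ge0// ltW.
have lim2 : \int[leb]_v (f (t_ n * v + y) * poisson 1 v)
    @[n --> \oo] --> \int[leb]_v (f y * poisson 1 v).
  have ip := integrable_poisson0 (@ltr01 R).
  apply: (@Rdominated_cvg _ (measurableTypeR R) R leb _ _ (fun v => M * poisson 1 v)).
  - move=> n; apply: measurable_funM; last exact: measurable_poisson.
    by apply: measurableT_comp => //; apply: measurable_funD => //; exact: measurable_funM.
  - move=> v; apply: cvgM; last exact: cvg_cst.
    have lim : t_ n * v + y @[n --> \oo] --> y.
      rewrite -[X in _ --> X]add0r -(mul0r v); apply: cvgD; last exact: cvg_cst.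
      by apply: cvgM; [exact: cvg_harmonic|exact: cvg_cst].
    exact: (cvg_comp _ _ lim (cf y)).
  - exact: (integrableZl _ _ ip).
  - move=> n v; rewrite normrM [`|poisson _ _|]ger0_norm ?poisson_ge0//.
    by rewrite ler_wpM2r// poisson_ge0.
have E n : \int[leb]_z (expR (- (t_ n * `|z|)) * inversion_integrand f y z) =
    \int[leb]_v (f (t_ n * v + y) * poisson 1 v).
  by rewrite abel_inversion// (poisson_rescaled _ _ mf fM).
have := lim1; under eq_fun do rewrite E.
move=> /(cvg_unique _ lim2) <-//.
have ip := integrable_poisson0 (@ltr01 R).
rewrite RintegralZl// mulrC; congr (_ * _).
rewrite /Rintegral -[RHS]/(fine (2 * pi)%:E) -(integral_poisson 0 (@ltr01 R)).
by congr fine; apply: eq_integral => v _; rewrite subr0.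
Qed.

End Inversion.

(** * Decay of the transform of a differentiable function *)

Section Derivatives.
Context (R : realType).

Lemma derivable_continuous (f : R -> R) : (forall x, derivable f x 1) -> continuous f.
Proof. by move=> df x; apply: differentiable_continuous; apply/derivable1_diffP. Qed.

Lemma continuous_is_derive (g dg : R -> R) :
  (forall x : R, is_derive x 1 g (dg x)) -> continuous g.
Proof. by move=> h; apply: derivable_continuous => x; have hx := h x; exact: ex_derive. Qed.

Lemma derivable_oo_LRcontinuous_is_derive (g dg : R -> R) (a b : R) :
  (forall x : R, is_derive x 1 g (dg x)) -> derivable_oo_LRcontinuous g a b.
Proof.
move=> h; have cg := continuous_is_derive h; split.
- by move=> x _; have hx := h x; exact: ex_derive.
- by apply: cvg_at_right_filter; exact: cg.
- by apply: cvg_at_left_filter; exact: cg.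
Qed.

(** Negating the boolean exchanges sine and cosine; the sign is that of the
    derivative of the cosine. *)
Lemma is_derive_trig (b : bool) (z x : R) :
  is_derive x 1 (fun x => trig (~~ b) (z * x)) ((-1) ^+ b * z * trig b (z * x)).
Proof.
have dl := is_derive_mulr z x.
case: b => /=.
  have ds : is_derive x 1 (cos \o *%R z) (- sin (z * x) * z).
    exact: is_derive1_comp.
  by apply: (is_derive_eq ds); ring.
have ds : is_derive x 1 (sin \o *%R z) (cos (z * x) * z).
  exact: is_derive1_comp.
by apply: (is_derive_eq ds); ring.
Qed.

Lemma trig_transform_patch (g : R -> R) (E : set R) (b : bool) (z : R) :
  trig_transform b (g \_ E) z = \int[leb]_(x in E) (g x * trig b (z * x)).
Proof.
rewrite [RHS]Rintegral_mkcond; apply: eq_Rintegral => x _.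
by rewrite /patch; case: ifP; rewrite ?mul0r.
Qed.

Lemma integrable_patch (g : R -> R) (a b : R) : continuous g ->
  leb.-integrable setT (EFin \o (g \_ `[a, b])).
Proof.
move=> cg; have ig : leb.-integrable `[a, b] (EFin \o g).
  apply: continuous_compact_integrable; first exact: segment_compact.
  exact: continuous_subspaceT.
rewrite -restrict_EFin; exact: ((@integrable_mkcond _ (measurableTypeR R) R leb `[a, b]%classic (EFin \o g) (measurable_itv _)).1 ig).
Qed.

End Derivatives.

Section Regularity.
Context (R : realType).
Variables (f df : R -> R).
Hypotheses (f_deriv : forall x : R, is_derive x 1 f (df x))
  (df_cont : continuous df) (f_int : leb.-integrable setT (EFin \o f)).

Let f_cont : continuous f.
Proof. exact: continuous_is_derive f_deriv. Qed.

Let N (n : nat) : R := n.+1%:R.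
Let D n : set R := `[- N n, N n].
(** The factor vanishes at both ends of [-N, N], so that integration by parts
    on that interval has no boundary terms, and its derivative stays bounded
    by 2 / N there. *)
Definition cutoff n x : R := f x * (1 - (N n)^-2 * x ^+ 2).
Definition dcutoff n x : R :=
  df x * (1 - (N n)^-2 * x ^+ 2) - f x * ((N n)^-2 * (2 * x)).

Let N_gt0 n : 0 < N n. Proof. by rewrite ltr0n. Qed.

Lemma is_derive_cutoff (n : nat) (x : R) : is_derive x 1 (cutoff n) (dcutoff n x).
Proof.
have d2 := is_deriveX 2 (@is_derive_id _ R^o x 1).
have dc := is_deriveB (@is_derive_cst _ R^o R^o (1 : R) x 1) (is_deriveZ ((N n)^-2) d2).
have := is_deriveM (f_deriv x) dc.
have -> : f * (cst 1 - (N n)^-2 *: (@id R ^+ 2)) = cutoff n by apply/funext.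
move=> h; apply: (is_derive_eq h).
have -> : (cst 1 - (N n)^-2 *: (@id R ^+ 2)) x = 1 - (N n)^-2 * x ^+ 2 by [].
by rewrite /dcutoff sub0r /GRing.scale/= expr1 mulr1; ring.
Qed.

Lemma continuous_dcutoff n : continuous (dcutoff n).
Proof.
move=> x; apply: cvgB; apply: cvgM; [exact: df_cont| |exact: f_cont|].
  apply: cvgB; first exact: cvg_cst.
  by apply: cvgM; [exact: cvg_cst|exact: exprn_continuous].
by apply: cvgM; [exact: cvg_cst|apply: cvgM; [exact: cvg_cst|exact: cvg_id]].
Qed.

(** Up to sign, multiplying one of the two transforms by z gives the other
    transform of the derivative. *)
Lemma cutoff_by_parts (n : nat) (b : bool) (z : R) :
  (-1) ^+ b * z * \int[leb]_(x in D n) (cutoff n x * trig b (z * x)) =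
  - \int[leb]_(x in D n) (dcutoff n x * trig (~~ b) (z * x)).
Proof.
have NN : - N n < N n by rewrite gtrN.
have cut0 x : x ^+ 2 = N n ^+ 2 -> cutoff n x = 0.
  move=> E; rewrite /cutoff E mulVf ?subrr ?mulr0//.
  by rewrite expf_neq0// gt_eqF.
have ctrig (c : bool) : continuous (fun x : R => trig c (z * x)).
  exact: (@continuous_mulr_comp _ _ z (@continuous_trig R c)).
have := @Rintegration_by_parts R (cutoff n) (fun x => trig (~~ b) (z * x))
  (dcutoff n) (fun x => (-1) ^+ b * z * trig b (z * x)) (- N n) (N n) NN.
rewrite !cut0 ?sqrrN// !mul0r subrr sub0r => <-.
- rewrite -RintegralZl//.
  + by apply: eq_Rintegral => x _; rewrite mulrCA mulrA.
  + exact: measurable_itv.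
  + apply: continuous_compact_integrable; first exact: segment_compact.
    apply: continuous_subspaceT => x; apply: cvgM; last exact: ctrig.
    exact: (continuous_is_derive (is_derive_cutoff n)).
- by apply: continuous_subspaceT; exact: continuous_dcutoff.
- exact: derivable_oo_LRcontinuous_is_derive (is_derive_cutoff n).
- by move=> x _; rewrite derive1E; apply: derive_val; exact: is_derive_cutoff.
- by apply: continuous_subspaceT => x; apply: cvgM; [exact: cvg_cst|exact: ctrig].
- exact: derivable_oo_LRcontinuous_is_derive (is_derive_trig b z).
- by move=> x _; rewrite derive1E; apply: derive_val; exact: is_derive_trig.
Qed.

Lemma cutoff_weight n x : D n x -> 0 <= (N n)^-2 * x ^+ 2 <= 1.
Proof.
rewrite /D /= in_itv/= -ler_norml => xN.
rewrite mulr_ge0 ?invr_ge0 ?sqr_ge0//= ler_pdivrMl ?exprn_gt0// mulr1.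
by rewrite -real_normK ?num_real// ler_sqr ?nnegrE ?(ltW (N_gt0 n)).
Qed.

Lemma dcutoff_sqr_le n x : D n x ->
  dcutoff n x ^+ 2 <= 2 * df x ^+ 2 + 8 * f x ^+ 2.
Proof.
move=> /cutoff_weight/andP[x20 x2].
have N1 : 1 <= N n by rewrite ler1n.
have y2 : ((N n)^-2 * (2 * x)) ^+ 2 <= 4.
  have -> : ((N n)^-2 * (2 * x)) ^+ 2 = 4 * ((N n)^-2 * ((N n)^-2 * x ^+ 2)) by ring.
  rewrite ler_piMr// mulr_ile1 ?invr_ge0 ?sqr_ge0//.
  by rewrite invf_le1 ?exprn_gt0// exprn_ege1.
rewrite /dcutoff; set u := 1 - _; set v := (N n)^-2 * (2 * x).
have u2 : u ^+ 2 <= 1.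
  by rewrite /u; move: x2 x20; move: (_ * _) => w w1 w0; nra.
apply: (@le_trans _ _ (2 * (df x * u) ^+ 2 + 2 * (f x * v) ^+ 2)).
  by have := sqr_ge0 (df x * u + f x * v); nra.
rewrite [(df x * u) ^+ 2]exprMn [(f x * v) ^+ 2]exprMn lerD//; first by rewrite ler_wpM2l// ler_piMr// sqr_ge0.
have -> : 8 * f x ^+ 2 = 2 * (f x ^+ 2 * 4) by ring.
by rewrite ler_wpM2l// ler_wpM2l ?sqr_ge0.
Qed.

(** The derivative need not be integrable, so its transform is not available.
    Bessel's inequality applies to the derivatives of the cut-off functions
    instead, with a bound that does not depend on the cut-off, and Fatou's
    lemma concludes. *)
Lemma integral_trig_transform_deriv b :
  (\int[leb]_z ((z * trig_transform b f z) ^+ 2)%:E <=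
   (2 * pi)%:E * \int[leb]_x (2 * df x ^+ 2 + 8 * f x ^+ 2)%:E)%E.
Proof.
have icut n : leb.-integrable setT (EFin \o (cutoff n \_ (D n))).
  apply: integrable_patch; exact: (continuous_is_derive (is_derive_cutoff n)).
have idcut n : leb.-integrable setT (EFin \o (dcutoff n \_ (D n))).
  apply: integrable_patch; exact: continuous_dcutoff.
pose F n z := ((z * trig_transform b (cutoff n \_ (D n)) z) ^+ 2)%:E.
apply: (@fatou_bound _ (measurableTypeR R) R leb F _ (fun=> _)); last exact: cvg_cst.
- move=> n; apply/measurable_EFinP; apply: measurable_funX; apply: measurable_funM => //.
  apply: measurable_trig_transform.
  by have /integrableP[/measurable_EFinP] := icut n.
- by move=> n z; rewrite lee_fin sqr_ge0.
- move=> z; apply: cvg_EFin; first exact: nearW.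
  suff lim : trig_transform b (cutoff n \_ (D n)) z @[n --> \oo] --> trig_transform b f z.
    have lim2 : z * trig_transform b (cutoff n \_ (D n)) z @[n --> \oo] -->
        z * trig_transform b f z by apply: cvgM => //; exact: cvg_cst.
    exact: (cvg_comp _ _ lim2 (@exprn_continuous R 2 (z * trig_transform b f z))).
  apply: (@Rdominated_cvg _ (measurableTypeR R) R leb _ _ (fun x => `|f x|)).
  + move=> n; have /integrableP[/measurable_EFinP mc _] := icut n.
    apply: measurable_funM => //.
    by apply: measurableT_comp; [exact: measurable_trig|exact: measurable_funM].
  + move=> x; apply: cvgM; last exact: cvg_cst.
    have lim : cutoff n x @[n --> \oo] --> f x.
      rewrite -[X in _ --> X]mulr1; apply: cvgM; first exact: cvg_cst.
      rewrite -[X in _ --> X]subr0; apply: cvgB; first exact: cvg_cst.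
      rewrite -(mul0r (x ^+ 2)); apply: cvgM; last exact: cvg_cst.
      rewrite -(mul0r 0); under eq_fun do rewrite -exprVn expr2.
      by apply: cvgM; exact: cvg_harmonic.
    apply: cvg_trans lim; apply: near_eq_cvg.
    have := nbhs_infty_gtr `|x|; apply: filterS => n nx.
    rewrite /patch ifT// inE /D/= in_itv/= -ler_norml.
    by rewrite (le_trans (ltW nx))// /N ler_nat.
  + exact: integrable_abse f_int.
  + move=> n x; rewrite normrM.
    apply: (@le_trans _ _ `|(cutoff n \_ (D n)) x|).
      by rewrite ler_piMr ?normr_ge0 ?trig_le1.
    rewrite /patch; case: ifPn; last by rewrite normr0.
    rewrite inE => /cutoff_weight/andP[x20 x2].
    rewrite /cutoff normrM ler_piMr//.
    move: x2 x20; move: (_ * _) => u u1 u0; rewrite ger0_norm; lra.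
- move=> n.
  rewrite (_ : \int[leb]_z F n z =
    \int[leb]_z (trig_transform (~~ b) (dcutoff n \_ (D n)) z ^+ 2)%:E)%E; last first.
    apply: eq_integral => z _; rewrite /F; congr EFin.
    rewrite !trig_transform_patch -[RHS]sqrrN -cutoff_by_parts.
    by rewrite -mulrA [RHS]exprMn sqrr_sign mul1r.
  apply: (le_trans (bessel _ (idcut n))).
  apply: lee_pmul => //; rewrite ?lee_fin ?mulr_ge0 ?pi_ge0//.
  + by apply: integral_ge0 => x _; rewrite lee_fin sqr_ge0.
  + apply: ge0_le_lower_integral => x; rewrite lee_fin ?sqr_ge0//.
    rewrite /patch; case: ifPn; first by rewrite inE; exact: dcutoff_sqr_le.
    by rewrite expr0n/= => _; rewrite addr_ge0// mulr_ge0// sqr_ge0.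
Qed.

End Regularity.

(** * Inversion in the mean *)

Section LimitInMean.
Context (R : realType).
Implicit Types (f g : R -> R).

(** From 2 |T| <= (1 + z^2) T^2 + 1 / (1 + z^2). *)
Lemma integrable_trig_transform f (b : bool) :
  leb.-integrable setT (EFin \o f) ->
  (\int[leb]_x (f x ^+ 2)%:E < +oo)%E ->
  (\int[leb]_z ((z * trig_transform b f z) ^+ 2)%:E < +oo)%E ->
  leb.-integrable setT (EFin \o trig_transform b f).
Proof.
move=> intf f2 zf2; have [/measurable_EFinP mf _] := integrableP _ _ _ intf.
have mT := measurable_trig_transform b mf.
apply/integrableP; split; first exact/measurable_EFinP.
pose h1 z := (trig_transform b f z ^+ 2)%:E.
pose h2 z := ((z * trig_transform b f z) ^+ 2)%:E.
pose h3 z : \bar R := (poisson 1 z)%:E.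
have m1 : measurable_fun [set: measurableTypeR R] h1.
  by apply/measurable_EFinP; exact: measurable_funX.
have m2 : measurable_fun [set: measurableTypeR R] h2.
  by apply/measurable_EFinP; apply: measurable_funX; exact: measurable_funM.
have m3 : measurable_fun [set: measurableTypeR R] h3.
  by apply/measurable_EFinP; exact: measurable_poisson.
have h10 z : (0 <= h1 z)%E by rewrite lee_fin sqr_ge0.
have h20 z : (0 <= h2 z)%E by rewrite lee_fin sqr_ge0.
have h30 z : (0 <= h3 z)%E by rewrite lee_fin poisson_ge0.
apply: (@le_lt_trans _ _ (\int[leb]_z (h1 z + h2 z + h3 z))%E).
  apply: ge0_le_lower_integral => z; first exact: abse_ge0.
  rewrite /h1 /h2 /h3 /= -!EFinD lee_fin /poisson expr1n mulr1.
  have z1 : 0 < 1 + z ^+ 2 by rewrite ltr_pwDl// sqr_ge0.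
  set T := trig_transform b f z.
  rewrite -subr_ge0 (_ : _ - _ = (1 + z ^+ 2) * (`|T| - (1 + z ^+ 2)^-1) ^+ 2
     + `|T| + (1 + z ^+ 2)^-1).
    by rewrite !addr_ge0// ?invr_ge0 ?(ltW z1)// mulr_ge0 ?sqr_ge0 ?(ltW z1).
  rewrite exprMn -[T ^+ 2]real_normK ?num_real//.
  by field; rewrite gt_eqF.
rewrite ge0_integralD//; last by apply: emeasurable_funD.
rewrite ge0_integralD// lte_add_pinfty//; first apply: lte_add_pinfty => //.
- apply: le_lt_trans (bessel b intf) _; rewrite lte_mul_pinfty//.
  by rewrite lee_fin mulr_ge0 ?pi_ge0.
- have := integral_poisson 0 (@ltr01 R) => E.
  rewrite (_ : \int[leb]_z h3 z = (2 * pi)%:E)%E ?ltry// -E.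
  by apply: eq_integral => z _; rewrite subr0.
- by move=> z _; rewrite adde_ge0.
Qed.

Lemma integrable_sqr_itv (H : R -> R) (a b : R) : measurable_fun setT H ->
  (\int[leb]_z (H z ^+ 2)%:E < +oo)%E ->
  leb.-integrable setT (EFin \o (H \_ `[a, b])).
Proof.
move=> mH H2.
rewrite -restrict_EFin; apply: ((@integrable_mkcond _ (measurableTypeR R) R leb `[a, b]%classic (EFin \o H) (measurable_itv _)).1).
have m1 : measurable_fun [set: measurableTypeR R] (EFin \o H) by exact/measurable_EFinP.
apply/integrableP; split; first exact: measurable_funTS.
have m2 : measurable_fun [set: measurableTypeR R] (fun z => (H z ^+ 2)%:E).
  by apply/measurable_EFinP; exact: measurable_funX.
apply: (@le_lt_trans _ _ (\int[leb]_(z in `[a, b]) (1 + (H z ^+ 2)%:E))%E).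
  apply: ge0_le_integral => //.
  - by apply: measurableT_comp => //; exact: measurable_funTS.
  - by apply: emeasurable_funD => //; exact: measurable_funTS.
  - move=> z _; rewrite /= -EFinD lee_fin -[H z ^+ 2]real_normK ?num_real//.
    by have := sqr_ge0 (`|H z| - 2^-1); nra.
rewrite ge0_integralD//; last 2 first.
- by move=> z _; rewrite lee_fin sqr_ge0.
- exact: measurable_funTS.
rewrite lte_add_pinfty//.
  rewrite integral_cst//= mul1e lebesgue_measure_itv/=.
  by case: ifP => _; rewrite ?ltry// -EFinD ltry.
apply: le_lt_trans H2; apply: ge0_subset_integral => //.
by move=> z _; rewrite lee_fin sqr_ge0.
Qed.

(** The truncated inversion integrals of (G1, G2) differ from those of the
    transform of f by the transform of a truncated difference, which Bessel's
    inequality bounds uniformly. Since the truncated integrals for f converge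
    pointwise to f, Fatou's lemma suffices. *)
Lemma limit_in_mean_bound (f g G1 G2 : R -> R) (M : R) (a : nat -> \bar R) :
  continuous f -> (forall x, `|f x| <= M) ->
  leb.-integrable setT (EFin \o f) ->
  leb.-integrable setT (EFin \o trig_transform false f) ->
  leb.-integrable setT (EFin \o trig_transform true f) ->
  measurable_fun setT G1 -> measurable_fun setT G2 -> measurable_fun setT g ->
  (forall n, (\int[leb]_y ((g y - (2 * pi)^-1 *
     \int[leb]_(z in `[- n%:R, n%:R])
        (cos (z * y) * G1 z + sin (z * y) * G2 z)) ^+ 2)%:E <= a n)%E) ->
  a @ \oo --> 0%E ->
  (\int[leb]_y ((g y - f y) ^+ 2)%:E <=
   (2 * pi^-1)%:E * \int[leb]_z ((G1 z - trig_transform false f z) ^+ 2 +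
     (G2 z - trig_transform true f z) ^+ 2)%:E)%E.
Proof.
move=> cf fM intf intC intS mG1 mG2 mg ga a0.
have mf : measurable_fun setT f by exact: continuous_measurable_fun.
set C := trig_transform false f; set S := trig_transform true f.
have mC : measurable_fun setT C by exact: measurable_trig_transform.
have mS : measurable_fun setT S by exact: measurable_trig_transform.
pose H1 z := G1 z - C z; pose H2 z := G2 z - S z.
have mH1 : measurable_fun setT H1 by exact: measurable_funB.
have mH2 : measurable_fun setT H2 by exact: measurable_funB.
have pi0 := @pi_gt0 R.
have c0 : 0 < 2 * (pi : R)^-1 by rewrite mulr_gt0// invr_gt0.
set I' := (X in (_ <= _ * X)%E).
have I'0 : (0 <= I')%E.
  by apply: integral_ge0 => z _; rewrite lee_fin addr_ge0// sqr_ge0.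
have [->|I'y] := eqVneq I' +oo%E; first by rewrite gt0_muley ?lte_fin// leey.
have {}I'y : (I' < +oo)%E by rewrite ltey.
have m1 : measurable_fun [set: measurableTypeR R] (fun z => (H1 z ^+ 2)%:E).
  by apply/measurable_EFinP; exact: measurable_funX.
have m2 : measurable_fun [set: measurableTypeR R] (fun z => (H2 z ^+ 2)%:E).
  by apply/measurable_EFinP; exact: measurable_funX.
have EI' : (I' = \int[leb]_z (H1 z ^+ 2)%:E + \int[leb]_z (H2 z ^+ 2)%:E)%E.
  rewrite -ge0_integralD//.
  - by move=> z _; rewrite lee_fin sqr_ge0.
  - by move=> z _; rewrite lee_fin sqr_ge0.
have H1y : (\int[leb]_z (H1 z ^+ 2)%:E < +oo)%E.
  apply: le_lt_trans I'y; rewrite EI' leeDl//.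
  by apply: integral_ge0 => z _; rewrite lee_fin sqr_ge0.
have H2y : (\int[leb]_z (H2 z ^+ 2)%:E < +oo)%E.
  apply: le_lt_trans I'y; rewrite EI' leeDr//.
  by apply: integral_ge0 => z _; rewrite lee_fin sqr_ge0.
pose D (n : nat) : set R := `[- n%:R, n%:R]%classic.
have iH1 n := integrable_sqr_itv (- n%:R) n%:R mH1 H1y.
have iH2 n := integrable_sqr_itv (- n%:R) n%:R mH2 H2y.
have iinv y : leb.-integrable setT (EFin \o inversion_integrand f y).
  have msin : measurable_fun setT (fun z : R => sin (y * z)).
    by apply: measurableT_comp; [exact: (measurable_trig true)|exact: measurable_funM].
  have ic := integrable_mul_le1 intC (measurable_cosM y) (fun=> cos_max _).
  have is' := integrable_mul_le1 intS msin (fun=> trig_le1 true _).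
  have := integrableD measurableT ic is'.
  apply: eq_integrable => // z _; rewrite /inversion_integrand /= -EFinD.
  by congr EFin; rewrite !(mulrC z); ring.
pose J n y := (2 * pi)^-1 * \int[leb]_z ((inversion_integrand f y \_ (D n)) z).
have Jf y : J n y @[n --> \oo] --> f y.
  rewrite (_ : f y = (2 * pi)^-1 * (2 * pi * f y)); last first.
    by rewrite mulrA mulVf ?mul1r// mulf_neq0 ?(gt_eqF pi0)//.
  rewrite -(inversion cf fM intf (iinv y)).
  apply: cvgM; first exact: cvg_cst.
  have [/measurable_EFinP mi _] := integrableP _ _ _ (iinv y).
  apply: (@Rdominated_cvg _ (measurableTypeR R) R leb _ _
    (fun z => `|inversion_integrand f y z|)).
  - move=> n; apply: (measurable_restrictT _ (measurable_itv _)).1.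
    exact: measurable_funTS.
  - move=> z; apply: cvg_near_cst.
    have := nbhs_infty_gtr `|z|; apply: filterS => n nz.
    by rewrite /patch ifT// inE /D/= in_itv/= -ler_norml ltW.
  - exact: integrable_abse (iinv y).
  - by move=> n z; rewrite /patch; case: ifP => // _; rewrite normr0.
pose In n y := (2 * pi)^-1 *
     \int[leb]_(z in `[- n%:R, n%:R]) (cos (z * y) * G1 z + sin (z * y) * G2 z).
have EIJ n y : In n y - J n y = (2 * pi)^-1 *
    (trig_transform false (H1 \_ (D n)) y + trig_transform true (H2 \_ (D n)) y).
  rewrite /In /J -mulrBr; congr (_ * _).
  have it1 := integrable_trig false y (iH1 n).
  have it2 := integrable_trig true y (iH2 n).
  rewrite /trig_transform -RintegralD// Rintegral_mkcond.
  have iD : leb.-integrable setT (EFin \o (inversion_integrand f y \_ (D n))).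
    rewrite -restrict_EFin; apply: ((@integrable_mkcond _ (measurableTypeR R) R leb (D n) _ (measurable_itv _)).1).
    by apply: (integrableS measurableT _ _ (iinv y)) => //; exact: measurable_itv.
  apply/eqP; rewrite subr_eq addrC -RintegralD//; last exact: (integrableD measurableT it1 it2).
  apply/eqP; apply: eq_Rintegral => z _.
  rewrite /patch /D /inversion_integrand /H1 /H2 -/C -/S /=.
  by case: ifP => _; rewrite ?mul0r ?addr0// !(mulrC z); ring.
pose F n y := ((g y - J n y) ^+ 2)%:E.
have mJ n : measurable_fun setT (J n).
  apply: measurable_funM => //.
  pose h (q : measurableTypeR R * measurableTypeR R) :=
    inversion_integrand f q.1 q.2 * \1_(D n) q.2.
  rewrite (_ : (fun _ => _) = (fun y => \int[leb]_z h (y, z))).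
    apply: (@measurable_Rintegral_param _ _ (measurableTypeR R) (measurableTypeR R) R leb h).
    apply: measurable_funM.
      have mm : measurable_fun setT (fun q : measurableTypeR R * measurableTypeR R => q.2 * q.1).
        exact: measurable_funM.
      apply: measurable_funD; apply: measurable_funM.
      - exact: (measurableT_comp (measurable_trig false) mm).
      - exact: (measurableT_comp mC).
      - exact: (measurableT_comp (measurable_trig true) mm).
      - exact: (measurableT_comp mS).
    have mD : measurable_fun [set: measurableTypeR R] (\1_(D n) : measurableTypeR R -> R).
      by apply: measurable_indic; exact: measurable_itv.
    exact: (measurableT_comp mD measurable_snd).
  apply/funext => y; apply: eq_Rintegral => z _; rewrite /h /patch indicE.
  by case: (z \in D n); rewrite ?mulr1 ?mulr0.
apply: (@fatou_bound _ (measurableTypeR R) R leb F _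
  (fun n => 2%:E * a n + (2 * pi^-1)%:E * I')%E).
- move=> n; apply/measurable_EFinP; apply: measurable_funX; apply: measurable_funB; [exact: mg|exact: mJ].
- by move=> n y; rewrite lee_fin sqr_ge0.
- move=> y; apply: cvg_EFin; first exact: nearW.
  have lim : g y - J n y @[n --> \oo] --> g y - f y by apply: cvgB => //; exact: cvg_cst.
  exact: (cvg_comp _ _ lim (@exprn_continuous R 2 (g y - f y))).
- move=> n.
  (* (u + v (A + A'))^2 <= 2 u^2 + 4 v^2 (A^2 + A'^2), with v = 1 / (2 pi) *)
  pose k : R := 4 * (2 * pi)^-1 ^+ 2.
  have k0 : 0 <= k by rewrite mulr_ge0// sqr_ge0.
  pose B y : \bar R := (k%:E * ((trig_transform false (H1 \_ (D n)) y ^+ 2)%:E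
      + (trig_transform true (H2 \_ (D n)) y ^+ 2)%:E))%E.
  have mt1 : measurable_fun [set: measurableTypeR R]
      (fun y => (trig_transform false (H1 \_ (D n)) y ^+ 2)%:E).
    apply/measurable_EFinP; apply: measurable_funX; apply: measurable_trig_transform.
    by have /integrableP[/measurable_EFinP] := iH1 n.
  have mt2 : measurable_fun [set: measurableTypeR R]
      (fun y => (trig_transform true (H2 \_ (D n)) y ^+ 2)%:E).
    apply/measurable_EFinP; apply: measurable_funX; apply: measurable_trig_transform.
    by have /integrableP[/measurable_EFinP] := iH2 n.
  apply: (@le_trans _ _ (2%:E * \int[leb]_y ((g y - In n y) ^+ 2)%:E + \int[leb]_y B y)%E).
    apply: lower_integral_le => //.
    - by move=> y; rewrite lee_fin sqr_ge0.
    - by move=> y; rewrite lee_fin sqr_ge0.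
    - by move=> y; apply: mule_ge0; [rewrite lee_fin|apply: adde_ge0; rewrite lee_fin sqr_ge0].
    - by apply: measurable_funeM; exact: emeasurable_funD.
    - move=> y; rewrite /F /B.
      rewrite -[leRHS]/((2 * (g y - In n y) ^+ 2 +
        k * (trig_transform false (H1 \_ (D n)) y ^+ 2 +
             trig_transform true (H2 \_ (D n)) y ^+ 2))%:E) lee_fin.
      rewrite (_ : g y - J n y = (g y - In n y) + (In n y - J n y)); last ring.
      rewrite EIJ /k; set u := g y - _; set v := (2 * pi)^-1.
      set A := trig_transform _ _ _; set A' := trig_transform _ _ _.
      have := sqr_ge0 (u - v * (A + A')); have := sqr_ge0 (v * (A - A')).
      by clearbody u v A A'; nra.
  apply: leeD.
    by rewrite lee_pmul2l//; exact: ga.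
  rewrite /B ge0_integralZl//; last 2 first.
  - by apply: emeasurable_funD; [exact: mt1|exact: mt2].
  - by move=> y _; apply: adde_ge0; rewrite lee_fin sqr_ge0.
  have patch_le (H : R -> R) : (\int[leb]_x ((H \_ (D n)) x ^+ 2)%:E <= \int[leb]_x (H x ^+ 2)%:E)%E.
    apply: ge0_le_lower_integral => x; rewrite lee_fin ?sqr_ge0//.
    by rewrite /patch; case: ifP => // _; rewrite expr0n/= sqr_ge0.
  apply: (@le_trans _ _ (k%:E * ((2 * pi)%:E * I'))%E); last first.
    rewrite muleA -EFinM /k.
    have E (q : R) : q != 0 -> 4 * (2 * q)^-1 ^+ 2 * (2 * q) = 2 * q^-1.
      by move=> q0; field.
    by rewrite E// gt_eqF.
  apply: lee_pmul => //; rewrite ?lee_fin//.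
    by apply: integral_ge0 => y _; apply: adde_ge0; rewrite lee_fin sqr_ge0.
  rewrite ge0_integralD//; [|by move=> y _; rewrite lee_fin sqr_ge0|
     by move=> y _; rewrite lee_fin sqr_ge0].
  rewrite EI' ge0_muleDr; [|by apply: integral_ge0 => y _; rewrite lee_fin sqr_ge0|
     by apply: integral_ge0 => y _; rewrite lee_fin sqr_ge0].
  apply: leeD.
  + apply: (le_trans (bessel _ (iH1 n))); apply: lee_pmul => //.
      by rewrite lee_fin mulr_ge0// ltW.
    by apply: integral_ge0 => y _; rewrite lee_fin sqr_ge0.
  + apply: (le_trans (bessel _ (iH2 n))); apply: lee_pmul => //.
      by rewrite lee_fin mulr_ge0// ltW.
    by apply: integral_ge0 => y _; rewrite lee_fin sqr_ge0.
- rewrite -[X in _ --> X]add0e; apply: cvgeD.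
  + by rewrite fin_num_adde_defr.
  + by rewrite -(mule0 2%:E); apply: cvgeMl.
  + exact: cvg_cst.
Qed.

End LimitInMean.

(** * Wasserstein distance and trigonometric moments *)

Section DensityMeasure.
Local Open Scope ereal_scope.
Context d (T : measurableType d) (R : realType).
Variables (mu nu : {measure set T -> \bar R}) (g : T -> R).
Hypotheses (mg : measurable_fun setT g) (g0 : forall x, (0 <= g x)%R)
  (nuE : forall A, measurable A -> nu A = \int[mu]_(x in A) (g x)%:E).

Import HBNNSimple.

(** The definition of the density extends from indicators to simple functions,
    then to nonnegative functions by monotone convergence. *)
Lemma ge0_integral_density (f : T -> \bar R) :
  measurable_fun setT f -> (forall x, 0 <= f x) ->
  \int[nu]_x f x = \int[mu]_x (f x * (g x)%:E).
Proof.
move=> mf f0; have mgE : measurable_fun setT (EFin \o g) by exact/measurable_EFinP.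
pose h := nnsfun_approx measurableT mf.
have hf x : (EFin \o h n) x @[n --> \oo] --> f x by exact: cvg_nnsfun_approx.
have -> : \int[nu]_x f x = limn (fun n => \int[nu]_x (EFin \o h n) x).
  under eq_integral => x _ do rewrite -(cvg_lim _ (hf x))//.
  apply: monotone_convergence => //.
  - by move=> n; exact/measurable_EFinP.
  - by move=> n x _; rewrite lee_fin.
  - by move=> x _ a b ab; rewrite lee_fin; exact/lefP/nd_nnsfun_approx.
have hfg x : (EFin \o h n) x * (g x)%:E @[n --> \oo] --> f x * (g x)%:E.
  by apply: cvgeZr => //; exact: hf.
have -> : \int[mu]_x (f x * (g x)%:E) =
    limn (fun n => \int[mu]_x ((EFin \o h n) x * (g x)%:E)).
  under eq_integral => x _ do rewrite -(cvg_lim _ (hfg x))//.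
  apply: monotone_convergence => //.
  - by move=> n; apply: emeasurable_funM => //; exact/measurable_EFinP.
  - by move=> n x _; rewrite mule_ge0// lee_fin.
  - move=> x _ a b ab; rewrite lee_wpmul2r ?lee_fin//.
    exact/lefP/nd_nnsfun_approx.
suff E n : \int[nu]_x (EFin \o h n) x = \int[mu]_x ((EFin \o h n) x * (g x)%:E).
  by congr (limn _); apply/funext.
have mind r : measurable (h n @^-1` [set r]) by exact: measurable_funPTI.
transitivity (\int[nu]_x
   (\sum_(y \in range (h n)) (y * \1_(h n @^-1` [set y]) x)%:E)).
  by apply: eq_integral => t _; rewrite /= fimfunE -fsumEFin.
rewrite ge0_integral_fsum//; last 2 first.
- by move=> y; apply/measurable_EFinP; exact: measurable_funM.
- by move=> y x _; exact: nnfun_muleindic_ge0.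
transitivity (\int[mu]_x (\sum_(y \in range (h n))
    (y * \1_(h n @^-1` [set y]) x)%:E * (g x)%:E)); last first.
  apply: eq_integral => x _.
  rewrite -ge0_mule_fsuml => [|y]; last exact: nnfun_muleindic_ge0.
  by rewrite fsumEFin// -(fimfunE _ x).
rewrite ge0_integral_fsum//; last 2 first.
- by move=> y; apply: emeasurable_funM => //; apply/measurable_EFinP; exact: measurable_funM.
- by move=> y x _; apply: mule_ge0; [exact: nnfun_muleindic_ge0|rewrite lee_fin].
apply: eq_fsbigr => r /set_mem [x0 _ hx0].
have r0 : (0 <= r)%R by rewrite -hx0.
have mi : measurable_fun setT (fun x => (\1_(h n @^-1` [set r]) x)%:E : \bar R).
  by apply/measurable_EFinP; exact: measurable_indic.
under eq_integral do rewrite EFinM.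
under [RHS]eq_integral do rewrite EFinM -muleA.
rewrite ge0_integralZl//.
rewrite ge0_integralZl//; last 2 first.
- exact: emeasurable_funM.
- by move=> x _; rewrite mule_ge0 ?lee_fin.
congr (_ * _); rewrite integral_indic// setIT nuE// integral_mkcond.
apply: eq_integral => x _; rewrite /patch indicE.
by case: (x \in _); rewrite ?mul1e ?mul0e.
Qed.

End DensityMeasure.

Section Coupling.
Context (R : realType).

Lemma is_derive_lipschitz (k dk : R -> R) : (forall x : R, is_derive x 1 k (dk x)) ->
  (forall x, `|dk x| <= 1) -> forall x y, `|k x - k y| <= `|x - y|.
Proof.
move=> h k1; have ck : continuous k := continuous_is_derive h.
have main x y : x < y -> `|k y - k x| <= `|y - x|.
  move=> xy; have [c _ ->] := MVT xy (fun z _ => h z) (continuous_subspaceT ck).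
  by rewrite normrM ler_piMl.
move=> x y; case: (ltgtP x y) => [xy|xy|->]; last by rewrite !subrr.
  by rewrite distrC [leRHS]distrC main.
exact: main.
Qed.

Lemma trig_lipschitz b (x y : R) : `|trig b x - trig b y| <= `|x - y|.
Proof.
case: b => /=.
  apply: (@is_derive_lipschitz sin cos) => z; exact: cos_max.
apply: (@is_derive_lipschitz cos (fun z => - sin z)) => z.
by rewrite normrN ler_norml sin_geN1 sin_le1.
Qed.

Lemma ge0_integral_empirical N (Y : 'I_N -> R) (nu : {measure set (measurableTypeR R) -> \bar R})
    (f : R -> \bar R) :
  (forall A, measurable A -> nu A = empirical_law Y A) ->
  measurable_fun setT f -> (forall x, (0 <= f x)%E) ->
  (\int[nu]_x f x = (N%:R^-1)%:E * \sum_(i < N) f (Y i))%E.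
Proof.
move=> nuE mf f0.
have iN0 : 0 <= (N%:R : R)^-1 by rewrite invr_ge0.
(* sums of measures are indexed by natural numbers; the default 0 is never reached *)
pose Y' (k : nat) : measurableTypeR R := oapp Y 0 (insub k).
pose nu' := mscale (NngNum iN0) (msum (fun k => dirac (Y' k)) N).
have Y'E (i : 'I_N) : Y' i = Y i by rewrite /Y' valK.
transitivity (\int[nu']_x f x)%E.
  apply: eq_measure_integral => A mA _; rewrite nuE// /nu' /mscale/= /msum.
  by congr (_ * _)%E; apply: eq_bigr => i _; rewrite Y'E.
rewrite ge0_integral_mscale//; congr (_ * _)%E.
rewrite ge0_integral_measure_sum//; apply: eq_bigr => i _.
by rewrite integral_dirac// diracT mul1e Y'E.
Qed.

Section OneCoupling.
Variables (N : nat) (Y : 'I_N -> R) (q : R -> R).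
Hypotheses (N0 : (0 < N)%N) (mq : measurable_fun setT q)
  (q0 : forall x, 0 <= q x) (q1 : (\int[leb]_x (q x)%:E = 1)%E).

Lemma integrable_density : leb.-integrable setT (EFin \o q).
Proof.
apply/integrableP; split; first exact/measurable_EFinP.
by under eq_integral do rewrite /= ger0_norm//; rewrite q1 ltry.
Qed.

(** Both means are integrals over the coupling, and the kernel is
    |z|-Lipschitz. Adding 1 to it makes it nonnegative, so that the changes of
    measure are available without any integrability condition. *)
Lemma coupling_trig_le (gam : probability (R * R)%type R) b z :
  is_coupling (empirical_law Y) (density_law q) gam ->
  (`| N%:R^-1 * \sum_(i < N) trig b (z * Y i) - trig_transform b q z |%:E <=
   `|z|%:E * \int[gam]_q `|q.1 - q.2|%:E)%E.
Proof.
move=> cpl.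
pose k (x : R) := 1 + trig b (z * x).
have mtr : measurable_fun setT (fun x : R => trig b (z * x)).
  by apply: measurableT_comp; [exact: measurable_trig|exact: measurable_funM].
have mk : measurable_fun setT k by exact: measurable_funD.
have tN1 (x : R) : - 1 <= trig b x by have := trig_le1 b x; rewrite ler_norml => /andP[].
have t1 (x : R) : trig b x <= 1 by have := trig_le1 b x; rewrite ler_norml => /andP[].
have k0 x : 0 <= k x by rewrite /k -lerBlDl sub0r.
have k2 x : k x <= 2 by rewrite /k -lerBrDl; have := t1 (z * x); lra.
have mf1 : measurable_fun setT (fst : R * R -> measurableTypeR R) by exact: measurable_fst.
have mf2 : measurable_fun setT (snd : R * R -> measurableTypeR R) by exact: measurable_snd.
have mkE : measurable_fun [set: measurableTypeR R] (EFin \o k) by exact/measurable_EFinP.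
pose nu1 : {measure set (measurableTypeR R) -> \bar R} :=
  measure_function_pushforward__canonical__measure_function_Measure gam mf1.
pose nu2 : {measure set (measurableTypeR R) -> \bar R} :=
  measure_function_pushforward__canonical__measure_function_Measure gam mf2.
have E1 : (\int[gam]_q (k q.1)%:E = (1 + N%:R^-1 * \sum_(i < N) trig b (z * Y i))%:E)%E.
  transitivity (\int[nu1]_x (k x)%:E)%E.
    by symmetry; apply: (ge0_integral_pushforward mf1 gam measurableT) => // x _; rewrite lee_fin.
  rewrite (@ge0_integral_empirical N Y nu1 (EFin \o k))//.
  - rewrite sumEFin -EFinM; congr EFin; rewrite /k big_split/= sumr_const card_ord.
    by rewrite mulrDr mulVf// pnatr_eq0 -lt0n.
  - move=> A mA; rewrite -(cpl A mA).1 /nu1 /= /pushforward; congr (gam _).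
    by apply/seteqP; split => // -[x y] /= [].
have E2 : (\int[gam]_q (k q.2)%:E = (1 + trig_transform b q z)%:E)%E.
  transitivity (\int[nu2]_x (k x)%:E)%E.
    by symmetry; apply: (ge0_integral_pushforward mf2 gam measurableT) => // x _; rewrite lee_fin.
  rewrite (@ge0_integral_density _ (measurableTypeR R) R leb nu2 q mq q0 _ (EFin \o k))//.
  - have iq := integrable_density; have it := integrable_trig b z iq.
    rewrite -[1]/(fine 1%E) -q1 -/(Rintegral leb setT q) /trig_transform -RintegralD//.
    rewrite /Rintegral fineK; last exact: integrable_fin_num (integrableD measurableT iq it).
    by apply: eq_integral => x _; rewrite -EFinM /k; congr EFin; ring.
  - move=> A mA; have := (cpl A mA).2; rewrite /density_law => <-.
    rewrite /nu2 /= /pushforward; congr (gam _).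
    by apply/seteqP; split => // -[x y] /= [].
have ik (pr : R * R -> R) : measurable_fun setT pr -> gam.-integrable setT (EFin \o (k \o pr)).
  move=> mpr; apply: measurable_bounded_integrable => //.
  - by apply: (le_lt_trans (probability_le1 gam measurableT)); exact: ltry.
  - exact: measurableT_comp.
  - exists 2; split => // M M2 q' _ /=; rewrite ger0_norm//.
    by rewrite (le_trans (k2 _))// ltW.
have ik1 := ik fst measurable_fst; have ik2 := ik snd measurable_snd.
rewrite (_ : _ - _ = (1 + N%:R^-1 * \sum_(i < N) trig b (z * Y i)) - (1 + trig_transform b q z)); last ring.
rewrite -abse_EFin EFinB -E1 -E2 -integralB//.
have mD : measurable_fun setT (fun q : R * R => (`|q.1 - q.2|)%:E : \bar R).
  apply/measurable_EFinP; apply: measurableT_comp => //; exact: measurable_funB.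
rewrite -ge0_integralZl//.
apply: (le_trans (le_abse_integral _ _ _)) => //.
  by apply: emeasurable_funB; [exact: measurable_int ik1|exact: measurable_int ik2].
apply: ge0_le_lower_integral => // p.
rewrite -EFinB abse_EFin -EFinM lee_fin /k.
rewrite (_ : _ - _ = trig b (z * p.1) - trig b (z * p.2)); last ring.
by rewrite -normrM mulrBr; exact: trig_lipschitz.
Qed.

(** The infimum over couplings of the preceding bound. The case z = 0 is
    separate: if there were no coupling, the distance would be infinite and
    its product with 0 would be 0. *)
Lemma W1_trig_le b z :
  (`| N%:R^-1 * \sum_(i < N) trig b (z * Y i) - trig_transform b q z |%:E <=
   `|z|%:E * W1 (empirical_law Y) (density_law q))%E.
Proof.
have [->|z0] := eqVneq z 0.
  rewrite normr0 mul0e lee_fin normr_le0 subr_eq0; apply/eqP.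
  under eq_bigr do rewrite mul0r.
  rewrite sumr_const card_ord -[trig b 0 *+ N]mulr_natl mulrA mulVf ?mul1r ?pnatr_eq0 -?lt0n//.
  rewrite /trig_transform; under eq_Rintegral do rewrite mul0r.
  rewrite RintegralZr//; last exact: integrable_density.
  by rewrite /Rintegral q1 mul1r.
have z1 : 0 < `|z| by rewrite normr_gt0.
rewrite -lee_pdivrMl//; apply: le_ereal_inf_tmp => _ [gam cpl <-].
by rewrite lee_pdivrMl//; exact: coupling_trig_le.
Qed.

End OneCoupling.
End Coupling.

(** * Convolutions *)

Section Convolution.
Context (R : realType).
Variables (f q : R -> R) (M : R).
Hypotheses (mf : measurable_fun setT f) (fM : forall x, `|f x| <= M)
  (f_int : leb.-integrable setT (EFin \o f))
  (q_int : leb.-integrable setT (EFin \o q)).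

Let mq : measurable_fun setT q.
Proof. by have /integrableP[/measurable_EFinP] := q_int. Qed.

Let h (p : measurableTypeR R * measurableTypeR R) : R := f (p.1 - p.2) * q p.2.

Let mh : measurable_fun setT h.
Proof.
apply: measurable_funM; last exact: (measurableT_comp mq).
by apply: measurableT_comp => //; exact: measurable_funB.
Qed.

Let M0 : 0 <= M. Proof. exact: le_trans (normr_ge0 _) (fM 0). Qed.

Lemma integrable_conv_at x : leb.-integrable setT (fun y => (f (x - y) * q y)%:E).
Proof.
have iq := integrableZl measurableT M q_int.
apply: le_integrable iq => //.
  apply/measurable_EFinP; apply: measurable_funM => //.
  by apply: measurableT_comp => //; exact: measurable_funB.
move=> y _; rewrite /= lee_fin !normrM ler_wpM2r//.
by rewrite (le_trans (fM _))// ler_norm.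
Qed.

Lemma integrable_shift y : leb.-integrable setT (fun x => (f (x - y))%:E).
Proof.
have := integrable_affine (- y) ltr01 f_int.
by apply: eq_integrable => // x _; rewrite mul1r.
Qed.

Lemma Rintegral_shift (g : R -> R) y : leb.-integrable setT (EFin \o g) ->
  \int[leb]_x g (x + y) = \int[leb]_x g x.
Proof.
move=> ig; have := Rintegral_affine y ltr01 ig; rewrite invr1 mul1r => <-.
by apply: eq_Rintegral => x _; rewrite mul1r.
Qed.

(** By Tonelli's theorem this integral is the product of the L1 norms of f and
    q. *)
Lemma integral_abs_conv_lty : (\int[leb]_x \int[leb]_y `|h (x, y)|%:E < +oo)%E.
Proof.
pose h' (p : measurableTypeR R * measurableTypeR R) : \bar R := `|h p|%:E.
have mh' : measurable_fun setT h'.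
  by apply/measurable_EFinP; exact: measurableT_comp.
have h'0 p : (0 <= h' p)%E by rewrite lee_fin.
rewrite (@fubini_tonelli _ _ _ _ R leb leb h' mh' h'0).
have [_ foo] := integrableP _ _ _ f_int; have [_ qoo] := integrableP _ _ _ q_int.
have mqE : measurable_fun [set: measurableTypeR R] (fun y => `|(q y)%:E|%E).
  by apply: measurableT_comp => //; exact/measurable_EFinP.
apply: (@le_lt_trans _ _ (\int[leb]_y (`|(q y)%:E| * \int[leb]_x `|(f x)%:E|))%E).
  apply: ge0_le_lower_integral => y; first exact: integral_ge0.
  have mfE : measurable_fun [set: measurableTypeR R] (fun x => `|(f x)%:E|%E).
    by apply: measurableT_comp => //; exact/measurable_EFinP.
  have := ge0_integral_affine (- y) ltr01 mfE (fun=> abse_ge0 _).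
  rewrite mul1e => <-.
  have mfs : measurable_fun [set: measurableTypeR R] (fun x => `|(f (1 * x - y))%:E|%E).
    apply: (measurableT_comp mfE); exact: (@measurable_affine R 1 (- y)).
  rewrite -ge0_integralZl//.
  apply: ge0_le_lower_integral => x; first by rewrite /h' lee_fin.
  by rewrite /h' /h /= mul1r normrM mulrC.
rewrite ge0_integralZr//; last exact: integral_ge0.
rewrite lte_mul_pinfty//; first exact: integral_ge0.
by rewrite ge0_fin_numE//; exact: integral_ge0.
Qed.

Lemma measurable_conv : measurable_fun setT (conv f q).
Proof.
exact: (@measurable_Rintegral_param _ _ (measurableTypeR R) (measurableTypeR R) R leb h).
Qed.

Lemma conv_bounded x : `|conv f q x| <= M * \int[leb]_y `|q y|.
Proof.
apply: le_trans (le_normr_Rintegral _ (integrable_conv_at x)) _ => //.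
rewrite -RintegralZl//; last exact: integrable_abse q_int.
apply: le_Rintegral => //.
- exact: integrable_abse (integrable_conv_at x).
- exact: (integrableZl measurableT M (integrable_abse q_int)).
- by move=> y _; rewrite normrM ler_wpM2r.
Qed.

Lemma integrable_conv : leb.-integrable setT (EFin \o conv f q).
Proof.
apply/integrableP; split; first by apply/measurable_EFinP; exact: measurable_conv.
apply: le_lt_trans integral_abs_conv_lty.
apply: ge0_le_lower_integral => // x.
rewrite /= /conv EFin_normr_Rintegral//; last exact: integrable_conv_at.
by apply: le_abse_integral => //; have /integrableP[] := integrable_conv_at x.
Qed.

(** Fubini's theorem and the substitution of x + y for x. *)
Lemma trig_transform_conv b z : trig_transform b (conv f q) z =
  \int[leb]_y (q y * \int[leb]_x (f x * trig b (z * (x + y)))).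
Proof.
have mt : measurable_fun setT (fun x : R => trig b (z * x)).
  by apply: measurableT_comp; [exact: measurable_trig|exact: measurable_funM].
pose k (p : measurableTypeR R * measurableTypeR R) := h p * trig b (z * p.1).
have ik x : leb.-integrable setT (fun y => (k (x, y))%:E).
  have := integrableZr measurableT (trig b (z * x)) (integrable_conv_at x).
  by apply: eq_integrable => // y _; rewrite -EFinM.
have ift y : leb.-integrable setT (fun x => (f (x - y) * trig b (z * x))%:E).
  by apply: integrable_mul_le1 => //; [exact: integrable_shift|move=> x; exact: trig_le1].
transitivity (\int[leb]_x (\int[leb]_y k (x, y))).
  apply: eq_Rintegral => x _; rewrite /conv -RintegralZr//; exact: integrable_conv_at.
transitivity (\int[leb]_y (\int[leb]_x k (x, y))).
  apply: Rfubini.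
  - by apply: measurable_funM => //; exact: (measurableT_comp mt).
  - apply: le_lt_trans integral_abs_conv_lty; apply: ge0_le_lower_integral => x.
      exact: integral_ge0.
    apply: ge0_le_lower_integral => y; first by rewrite lee_fin.
    by rewrite lee_fin normrM ler_piMr ?trig_le1.
  - exact: ik.
  - move=> y; have := integrableZl measurableT (q y) (ift y).
    by apply: eq_integrable => // x _; rewrite /k /h /= -EFinM; congr EFin; ring.
apply: eq_Rintegral => y _.
have := Rintegral_shift y (ift y) => E.
rewrite (_ : \int[leb]_x (f x * trig b (z * (x + y))) =
  \int[leb]_x (f (x - y) * trig b (z * x))); last first.
  by rewrite -E; apply: eq_Rintegral => x _; rewrite addrK.
rewrite -RintegralZl//; last exact: ift.
by apply: eq_Rintegral => x _; rewrite /k /h /=; ring.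
Qed.

Lemma trig_transform_conv_cos z : trig_transform false (conv f q) z =
  trig_transform false f z * trig_transform false q z -
  trig_transform true f z * trig_transform true q z.
Proof.
have ic := integrable_trig false z q_int; have is' := integrable_trig true z q_int.
have jc := integrable_trig false z f_int; have js := integrable_trig true z f_int.
rewrite trig_transform_conv.
transitivity (\int[leb]_y (trig_transform false f z * (q y * cos (z * y)) -
   trig_transform true f z * (q y * sin (z * y)))).
  apply: eq_Rintegral => y _.
  transitivity (q y * \int[leb]_x ((f x * cos (z * x)) * cos (z * y) -
     (f x * sin (z * x)) * sin (z * y))).
    by congr (_ * _); apply: eq_Rintegral => x _; rewrite /= mulrDr cosD; ring.
  rewrite RintegralB//; last 2 first.
  - exact: (integrableZr measurableT _ jc).
  - exact: (integrableZr measurableT _ js).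
  rewrite (RintegralZr _ _ jc)// (RintegralZr _ _ js)//.
  by rewrite /trig_transform /=; ring.
rewrite RintegralB//; last 2 first.
- exact: (integrableZl measurableT _ ic).
- exact: (integrableZl measurableT _ is').
by rewrite (RintegralZl _ _ ic)// (RintegralZl _ _ is').
Qed.

Lemma trig_transform_conv_sin z : trig_transform true (conv f q) z =
  trig_transform true f z * trig_transform false q z +
  trig_transform false f z * trig_transform true q z.
Proof.
have ic := integrable_trig false z q_int; have is' := integrable_trig true z q_int.
have jc := integrable_trig false z f_int; have js := integrable_trig true z f_int.
rewrite trig_transform_conv.
transitivity (\int[leb]_y (trig_transform true f z * (q y * cos (z * y)) +
   trig_transform false f z * (q y * sin (z * y)))).
  apply: eq_Rintegral => y _.
  transitivity (q y * \int[leb]_x ((f x * sin (z * x)) * cos (z * y) +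
     (f x * cos (z * x)) * sin (z * y))).
    by congr (_ * _); apply: eq_Rintegral => x _; rewrite /= mulrDr sinD; ring.
  rewrite RintegralD//; last 2 first.
  - exact: (integrableZr measurableT _ js).
  - exact: (integrableZr measurableT _ jc).
  rewrite (RintegralZr _ _ jc)// (RintegralZr _ _ js)//.
  by rewrite /trig_transform /=; ring.
rewrite RintegralD//; last 2 first.
- exact: (integrableZl measurableT _ ic).
- exact: (integrableZl measurableT _ is').
by rewrite (RintegralZl _ _ ic)// (RintegralZl _ _ is').
Qed.

End Convolution.

(** * Complex Fourier transforms *)

Section FourierBridge.
Context (R : realType).

Lemma normc_sqr (w : R[i]) : normc w ^+ 2 = complex.Re w ^+ 2 + complex.Im w ^+ 2.
Proof. by case: w => a b /=; rewrite sqr_sqrtr// addr_ge0// sqr_ge0. Qed.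

Lemma normc_ge0 (w : R[i]) : 0 <= normc w.
Proof. by case: w => a b /=; exact: sqrtr_ge0. Qed.

Lemma fourierE (f : R -> R) z :
  fourier f z = trig_transform false f z +i* trig_transform true f z.
Proof.
by congr (_ +i* _); apply: eq_Rintegral => x _; rewrite /= /cis; ring.
Qed.

Lemma empirical_fourierE N (Y : 'I_N -> R) z : empirical_fourier Y z =
  (N%:R^-1 * \sum_(i < N) trig false (z * Y i)) +i*
  (N%:R^-1 * \sum_(i < N) trig true (z * Y i)).
Proof.
rewrite /empirical_fourier.
have -> : \sum_(i < N) cis (z * Y i) =
  (\sum_(i < N) trig false (z * Y i)) +i* (\sum_(i < N) trig true (z * Y i)).
  apply: (big_ind3 (fun (w : R[i]) (a b : R) => w = a +i* b)) => //.
  by move=> w1 a1 b1 w2 a2 b2 -> ->.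
by rewrite /real_complex_def; congr (_ +i* _) => /=; ring.
Qed.

Lemma Re_inv_fourier_trunc (G : R -> R[i]) n y :
  complex.Re (inv_fourier_trunc G n y) = (2 * pi)^-1 *
  \int[leb]_(z in `[- n%:R, n%:R])
    (cos (z * y) * complex.Re (G z) + sin (z * y) * complex.Im (G z)).
Proof.
rewrite /inv_fourier_trunc /= mul0r subr0; congr (_ * _).
apply: eq_Rintegral => z _; rewrite /cis; case: (G z) => a b /=.
by rewrite cosN sinN; ring.
Qed.

(** Only the real part of the inverse transform is compared with f: it is
    closer to the real function g than the inverse transform itself. *)
Lemma inv_fourier_error (G : R -> R[i]) (g f : R -> R) (M : R) :
  continuous f -> (forall x, `|f x| <= M) ->
  leb.-integrable setT (EFin \o f) ->
  (forall b, leb.-integrable setT (EFin \o trig_transform b f)) ->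
  measurable_fun setT (fun z => complex.Re (G z)) ->
  measurable_fun setT (fun z => complex.Im (G z)) ->
  is_inv_fourier G g ->
  (\int[leb]_y ((g y - f y) ^+ 2)%:E <=
   (2 * pi^-1)%:E * \int[leb]_z (normc (G z - fourier f z) ^+ 2)%:E)%E.
Proof.
move=> cf fM intf intT mRe mIm [mg lim].
apply: le_trans (@limit_in_mean_bound R f g _ _ M _ cf fM intf (intT false)
  (intT true) mRe mIm mg _ lim) _.
  move=> n; apply: ge0_le_lower_integral => y; first by rewrite lee_fin sqr_ge0.
  rewrite lee_fin normc_sqr -Re_inv_fourier_trunc.
  by case: (inv_fourier_trunc G n y) => a b /=; rewrite lerDl sqr_ge0.
rewrite (_ : \int[leb]_z (normc _ ^+ 2)%:E = \int[leb]_z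
   ((complex.Re (G z) - trig_transform false f z) ^+ 2 +
    (complex.Im (G z) - trig_transform true f z) ^+ 2)%:E)%E//.
apply: eq_integral => z _.
by rewrite normc_sqr fourierE; case: (G z) => a b /=.
Qed.

(** Here P is the estimated transform of Psi, - F q the true one, and e the
    approximation of q by which it is divided. The error inside the modulus
    has modulus |P + F e| / |e|, and P + F e = (P + F q) + F (e - q). *)
Lemma quotient_error (F q e P : R[i]) (w : R) : 0 < w -> w < normc e ->
  normc (- (P * conjc e / (normc e ^+ 2)%:C) - F) ^+ 2 <=
  2 * w ^- 2 * normc (P + F * q) ^+ 2 +
  2 * w ^- 2 * (normc F ^+ 2 * normc (e - q) ^+ 2).
Proof.
move=> w0 we.
have E0 : w ^+ 2 < normc e ^+ 2.
  by rewrite ltr_sqr ?nnegrE ?normc_ge0// ltW.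
have -> : ((normc e ^+ 2)%:C)^-1 = ((normc e ^+ 2)^-1)%:C :> R[i].
  by rewrite fmorphV.
case: F q e P we E0 => [C S] [q1 q2] [e1 e2] [p1 p2] we.
rewrite !normc_sqr /=; set E := e1 ^+ 2 + e2 ^+ 2 => E0.
have w20 : 0 < w ^+ 2 by rewrite exprn_gt0.
have Ep : 0 < E by exact: lt_trans E0.
(* a + i b = P + F q and c + i d = F (e - q) *)
pose a := p1 + (C * q1 - S * q2); pose b := p2 + (C * q2 + S * q1).
pose c := C * (e1 - q1) - S * (e2 - q2); pose d := C * (e2 - q2) + S * (e1 - q1).
rewrite (_ : _ + _ = ((a + c) ^+ 2 + (b + d) ^+ 2) / E); last first.
  by rewrite /a /b /c /d /E; field; rewrite -/E gt_eqF.
apply: (@le_trans _ _ (((a + c) ^+ 2 + (b + d) ^+ 2) / w ^+ 2)).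
  rewrite ler_wpM2l ?addr_ge0 ?sqr_ge0// lef_pV2 ?posrE//.
  exact: ltW.
rewrite [leRHS](_ : _ = (2 * (a ^+ 2 + b ^+ 2) + 2 * (c ^+ 2 + d ^+ 2)) / w ^+ 2).
  rewrite ler_wpM2r ?invr_ge0 ?(ltW w20)//.
  by have := sqr_ge0 (a - c); have := sqr_ge0 (b - d); nra.
by rewrite /a /b /c /d; ring.
Qed.

(** If |e| <= w < |q| / 2, then more than half of q is lost in e. *)
Lemma small_denominator_error (q e : R[i]) (w : R) : 0 < w ->
  normc e <= w -> 2 * w < normc q ->
  normc q ^+ 2 <= 4 * normc (e - q) ^+ 2.
Proof.
move=> w0 ew wq.
have tri : normc q <= normc e + normc (e - q).
  by rewrite -{1}(subKr e q) (le_trans (le_normcD _ _))// normcN.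
have h : normc q <= 2 * normc (e - q) by lra.
rewrite (_ : 4 * _ = (2 * normc (e - q)) ^+ 2); last ring.
by rewrite ler_sqr ?nnegrE ?normc_ge0// mulr_ge0// normc_ge0.
Qed.

End FourierBridge.

(** * The error for a given sample *)

Section ErrorDensity.
Context (R : realType).

(** The inverse is not continuous at 0, where it takes the value 0; it is the
    pointwise limit of the continuous functions x / (x^2 + 1/n), also at that
    point. *)
Lemma measurable_inv : measurable_fun setT (@GRing.inv R).
Proof.
pose f (n : nat) (x : R) := x / (x ^+ 2 + n.+1%:R^-1).
have den n (x : R) : x ^+ 2 + n.+1%:R^-1 != 0.
  by rewrite gt_eqF// ltr_wpDl ?sqr_ge0// invr_gt0.
have mf n : measurable_fun [set: R] (f n).
  apply: continuous_measurable_fun => x; apply: cvgM; first exact: cvg_id.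
  apply: cvgV; first exact: den.
  by apply: cvgD; [exact: exprn_continuous|exact: cvg_cst].
apply: (measurable_fun_cvg mf) => x _; rewrite /f.
have [->|x0] := eqVneq x 0.
  by rewrite invr0; under eq_fun do rewrite mul0r; exact: cvg_cst.
have -> : x^-1 = x * (x ^+ 2 + 0)^-1 by field.
apply: cvgM; first exact: cvg_cst.
apply: cvgV; first by rewrite addr0 expf_neq0.
by apply: cvgD; [exact: cvg_cst|exact: cvg_harmonic].
Qed.

(** The part of the squared error of the estimated transform that is due to
    replacing q by e: division by e above the threshold, frequencies that are
    lost because q is small, and those that are lost although q is large. *)
Definition error_density (w : R) (F q e : R[i]) : R :=
  2 * w ^- 2 * (normc F ^+ 2 * normc (e - q) ^+ 2) +
  (if normc q <= 2 * w then normc F ^+ 2 else 0) +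
  (if 2 * w < normc q then 4 * (normc F ^+ 2 * normc q ^- 2 * normc (e - q) ^+ 2)
   else 0).

Lemma error_density_ge0 w F q e : 0 <= error_density w F q e.
Proof.
have n0 := @normc_ge0 R.
rewrite /error_density !addr_ge0//; last 2 first.
- by case: ifP => // _; rewrite sqr_ge0.
- by case: ifP => // _; rewrite !mulr_ge0 ?invr_ge0 ?sqr_ge0.
by rewrite !mulr_ge0 ?invr_ge0 ?sqr_ge0.
Qed.

(** Above the threshold this is the bound for the quotient. Below it the whole
    of F is lost, and either q is small too or e is far from q. *)
Lemma threshold_error (F q e P : R[i]) (w : R) : 0 < w ->
  normc ((if w < normc e then - (P * conjc e / (normc e ^+ 2)%:C) else 0) - F) ^+ 2 <=
  2 * w ^- 2 * normc (P + F * q) ^+ 2 + error_density w F q e.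
Proof.
move=> w0; rewrite /error_density.
have c0 : 0 <= 2 * w ^- 2 by rewrite mulr_ge0// invr_ge0 sqr_ge0.
have F0 := sqr_ge0 (normc F); have D0 := sqr_ge0 (normc (e - q)).
have A0 : 0 <= 2 * w ^- 2 * normc (P + F * q) ^+ 2 by rewrite mulr_ge0 ?sqr_ge0.
have B0 : 0 <= 2 * w ^- 2 * (normc F ^+ 2 * normc (e - q) ^+ 2).
  by rewrite mulr_ge0// mulr_ge0.
have q20 : 0 <= normc q ^- 2 by rewrite invr_ge0 sqr_ge0.
case: ifPn => [we|]; last rewrite -leNgt => ew.
  apply: le_trans (quotient_error F q P w0 we) _.
  rewrite lerD2l -addrA lerDl addr_ge0//; first by case: ifP.
  by case: ifP => // _; rewrite mulr_ge0// mulr_ge0// mulr_ge0.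
rewrite sub0r (_ : normc (- F) = normc F); last exact: normcN.
case: (leP (normc q) (2 * w)) => qw.
  by rewrite addr0 addrA lerDr addr_ge0.
rewrite addr0 addrA (le_trans _ (_ : 4 * (normc F ^+ 2 * normc q ^- 2 * normc (e - q) ^+ 2) <= _))//.
  have := small_denominator_error w0 ew qw.
  have q0 : 0 < normc q ^+ 2.
    by rewrite exprn_gt0// (le_lt_trans _ qw)// mulr_ge0// ltW.
  move=> h; rewrite (_ : 4 * _ = normc F ^+ 2 * ((4 * normc (e - q) ^+ 2) / normc q ^+ 2)).
    by rewrite ler_peMr// ler_pdivlMr// mul1r.
  by ring.
by rewrite lerDr addr_ge0.
Qed.

Lemma measurable_normc d (T : measurableType d) (F : T -> R[i]) :
  measurable_fun setT (fun t => complex.Re (F t)) ->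
  measurable_fun setT (fun t => complex.Im (F t)) ->
  measurable_fun setT (fun t => normc (F t)).
Proof.
move=> mRe mIm; rewrite (_ : (fun _ => _) =
    Num.sqrt \o (fun t => complex.Re (F t) ^+ 2 + complex.Im (F t) ^+ 2)); last first.
  by apply/funext => t /=; case: (F t).
apply: measurableT_comp.
  by apply: continuous_measurable_fun; exact: sqrt_continuous.
by apply: measurable_funD; exact: measurable_funX.
Qed.

Lemma measurable_error_density d (T : measurableType d) (w : R) (F q e : T -> R[i]) :
  measurable_fun setT (fun t => complex.Re (F t)) ->
  measurable_fun setT (fun t => complex.Im (F t)) ->
  measurable_fun setT (fun t => complex.Re (q t)) ->
  measurable_fun setT (fun t => complex.Im (q t)) ->
  measurable_fun setT (fun t => complex.Re (e t)) ->
  measurable_fun setT (fun t => complex.Im (e t)) ->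
  measurable_fun setT (fun t => error_density w (F t) (q t) (e t)).
Proof.
move=> mF mF' mq mq' me me'.
have nF := measurable_normc mF mF'; have nq := measurable_normc mq mq'.
have neq : measurable_fun setT (fun t => normc (e t - q t)).
  apply: measurable_normc.
  - rewrite (_ : (fun _ => _) = (fun t => complex.Re (e t) - complex.Re (q t))).
      exact: measurable_funB.
    by apply/funext => t; case: (e t) (q t) => a b [].
  - rewrite (_ : (fun _ => _) = (fun t => complex.Im (e t) - complex.Im (q t))).
      exact: measurable_funB.
    by apply/funext => t; case: (e t) (q t) => a b [].
have nF2 := measurable_funX 2 nF; have neq2 := measurable_funX 2 neq.
have nq2 : measurable_fun setT (fun t => normc (q t) ^- 2).
  by apply: (measurableT_comp measurable_inv); exact: measurable_funX.
apply: measurable_funD; first apply: measurable_funD.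
- by apply: measurable_funM => //; exact: measurable_funM.
- apply: measurable_fun_ifT => //; exact: measurable_fun_ler.
- apply: measurable_fun_ifT => //; first exact: measurable_fun_ltr.
  by apply: measurable_funM => //; apply: measurable_funM => //; exact: measurable_funM.
Qed.

End ErrorDensity.

Section SampleError.
Context (R : realType).
Variables (f q : R -> R) (M : R).
Hypotheses (cf : continuous f) (fM : forall x, `|f x| <= M)
  (f_int : leb.-integrable setT (EFin \o f))
  (q_int : leb.-integrable setT (EFin \o q))
  (T_int : forall b, leb.-integrable setT (EFin \o trig_transform b f)).

Lemma sqr_bounded_lty (g : R -> R) (B : R) : leb.-integrable setT (EFin \o g) ->
  (forall x, `|g x| <= B) -> (\int[leb]_x (g x ^+ 2)%:E < +oo)%E.
Proof.
move=> ig gB; have [mg goo] := integrableP _ _ _ ig.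
have B0 : 0 <= B by exact: le_trans (normr_ge0 _) (gB 0).
apply: (@le_lt_trans _ _ (B%:E * \int[leb]_x `|(g x)%:E|)%E).
  rewrite -ge0_integralZl//; last exact: measurableT_comp.
  apply: ge0_le_lower_integral => x; first by rewrite lee_fin sqr_ge0.
  by rewrite -EFinM lee_fin -real_normK ?num_real// expr2 ler_wpM2r.
by rewrite lte_mul_pinfty//; rewrite ge0_fin_numE//; exact: integral_ge0.
Qed.

(** If the estimate of Psi is at infinite distance from Psi there is nothing
    to prove. Otherwise it is square integrable and of bounded support, hence
    integrable, so that its transform is a genuine integral and Bessel's
    inequality applies to its difference with Psi. *)
Lemma sample_error N (Y : 'I_N -> R) (Psihat g : R -> R) (w L : R) :
  0 < w -> measurable_fun setT Psihat ->
  (forall y, L < `|y| -> Psihat y = 0) ->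
  is_inv_fourier (fourier_beta'_est Y Psihat w) g ->
  (\int[leb]_y ((g y - f y) ^+ 2)%:E <=
   (16 * w ^- 2)%:E * \int[leb]_y ((Psihat y - - conv f q y) ^+ 2)%:E +
   (2 * pi^-1)%:E * \int[leb]_z (error_density w (fourier f z) (fourier q z)
      (empirical_fourier Y z))%:E)%E.
Proof.
move=> w0 mP PL inv.
have mf : measurable_fun setT f by exact: continuous_measurable_fun.
have mq : measurable_fun setT q by have /integrableP[/measurable_EFinP] := q_int.
have mc := measurable_conv mf q_int.
have c16 : 0 < 16 * w ^- 2 by rewrite mulr_gt0// invr_gt0 exprn_gt0.
have pi0 := @pi_gt0 R.
have c2 : 0 <= 2 * (pi : R)^-1 by rewrite mulr_ge0// invr_ge0 ltW.
set I := (\int[leb]_y ((Psihat y - _) ^+ 2)%:E)%E.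
have J0 : (0 <= \int[leb]_z (error_density w (fourier f z) (fourier q z)
      (empirical_fourier Y z))%:E)%E.
  by apply: integral_ge0 => z _; rewrite lee_fin error_density_ge0.
have [->|Iy] := eqVneq I +oo%E.
  rewrite gt0_muley ?lte_fin// addye ?leey// gt_eqF//.
  by rewrite (@lt_le_trans _ _ 0%E)// mule_ge0// lee_fin.
have {}Iy : (I < +oo)%E by rewrite ltey.
have ic := integrable_conv mf fM f_int q_int.
have c2y := sqr_bounded_lty ic (conv_bounded mf fM q_int).
pose D y := Psihat y + conv f q y.
have mD : measurable_fun setT D by exact: measurable_funD.
have IE : I = (\int[leb]_y (D y ^+ 2)%:E)%E.
  by apply: eq_integral => y _; rewrite opprK.
have P2y : (\int[leb]_y (Psihat y ^+ 2)%:E < +oo)%E.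
  apply: (@le_lt_trans _ _ (2%:E * I + \int[leb]_y (2 * conv f q y ^+ 2)%:E)%E).
    rewrite IE; apply: lower_integral_le => //.
    - by move=> y; rewrite lee_fin sqr_ge0.
    - by move=> y; rewrite lee_fin sqr_ge0.
    - by move=> y; rewrite lee_fin mulr_ge0// sqr_ge0.
    - by apply/measurable_EFinP; apply: measurable_funM => //; exact: measurable_funX.
    - move=> y; rewrite -EFinM -EFinD lee_fin /D.
      by have := sqr_ge0 (Psihat y + 2 * conv f q y); nra.
  under [X in (_ + X)%E]eq_integral do rewrite EFinM.
  rewrite ge0_integralZl//; last 2 first.
  - by apply/measurable_EFinP; exact: measurable_funX.
  - by move=> y _; rewrite lee_fin sqr_ge0.
  have I0 : (0 <= I)%E by apply: integral_ge0 => y _; rewrite lee_fin sqr_ge0.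
  by rewrite lte_add_pinfty// lte_mul_pinfty// ge0_fin_numE.
(* square integrable and supported in [-L, L] *)
have iP : leb.-integrable setT (EFin \o Psihat).
  have := integrable_sqr_itv (- L) L mP P2y.
  apply: eq_integrable => // y _; rewrite /= /patch; case: ifPn => //.
  rewrite notin_setE/= in_itv/= -ler_norml => /negP; rewrite -ltNge => Ly.
  by rewrite PL.
have iD : leb.-integrable setT (EFin \o D) by exact: (integrableD measurableT iP ic).
have TD b z : trig_transform b D z =
    trig_transform b Psihat z + trig_transform b (conv f q) z.
  have h1 := integrable_trig b z iP; have h2 := integrable_trig b z ic.
  rewrite /trig_transform -RintegralD//.
  by apply: eq_Rintegral => y _; rewrite /D mulrDl.
have mT b (h : R -> R) : measurable_fun setT h ->
    measurable_fun setT (trig_transform b h) by exact: measurable_trig_transform.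
have mE b : measurable_fun setT (fun z : R => N%:R^-1 * \sum_(i < N) trig b (z * Y i)).
  apply: measurable_funM => //; apply: measurable_sum => i.
  by apply: measurableT_comp; [exact: measurable_trig|exact: measurable_funM].
have mReE : measurable_fun setT (fun z => complex.Re (empirical_fourier Y z)).
  under eq_fun do rewrite empirical_fourierE /=; exact: (mE false).
have mImE : measurable_fun setT (fun z => complex.Im (empirical_fourier Y z)).
  under eq_fun do rewrite empirical_fourierE /=; exact: (mE true).
have mReF (h : R -> R) : measurable_fun setT h -> measurable_fun setT (fun z => complex.Re (fourier h z)).
  move=> mh; rewrite (_ : (fun _ => _) = trig_transform false h); first exact: mT.
  by apply/funext => z; rewrite fourierE.
have mImF (h : R -> R) : measurable_fun setT h -> measurable_fun setT (fun z => complex.Im (fourier h z)).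
  move=> mh; rewrite (_ : (fun _ => _) = trig_transform true h); first exact: mT.
  by apply/funext => z; rewrite fourierE.
pose G := fourier_beta'_est Y Psihat w.
have nE := measurable_normc mReE mImE.
have nE2 : measurable_fun setT (fun z => (normc (empirical_fourier Y z) ^+ 2)^-1).
  by apply: (measurableT_comp (@measurable_inv R)); exact: measurable_funX.
pose u z := - ((complex.Re (fourier Psihat z) * complex.Re (empirical_fourier Y z) +
        complex.Im (fourier Psihat z) * complex.Im (empirical_fourier Y z)) *
        (normc (empirical_fourier Y z) ^+ 2)^-1).
pose v z := - ((complex.Im (fourier Psihat z) * complex.Re (empirical_fourier Y z) -
        complex.Re (fourier Psihat z) * complex.Im (empirical_fourier Y z)) *
        (normc (empirical_fourier Y z) ^+ 2)^-1).
have GE z : G z = if w < normc (empirical_fourier Y z) then u z +i* v z else 0.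
  rewrite /G /fourier_beta'_est /u /v; case: ifP => // _.
  have -> : ((normc (empirical_fourier Y z) ^+ 2)%:C)^-1 =
     ((normc (empirical_fourier Y z) ^+ 2)^-1)%:C :> R[i] by rewrite fmorphV.
  case: (fourier Psihat z) => a b; case: (empirical_fourier Y z) => c d /=.
  by congr (_ +i* _); ring.
have mw : measurable_fun setT (fun z => w < normc (empirical_fourier Y z)).
  exact: measurable_fun_ltr.
have mReG : measurable_fun setT (fun z => complex.Re (G z)).
  rewrite (_ : (fun _ => _) = fun z => if w < normc (empirical_fourier Y z)
    then u z else 0); last by apply/funext => z; rewrite GE; case: ifP.
  apply: measurable_fun_ifT => //; apply: measurableT_comp => //.
  by apply: measurable_funM => //; apply: measurable_funD; apply: measurable_funM => //;
    [exact: mReF|exact: mImF].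
have mImG : measurable_fun setT (fun z => complex.Im (G z)).
  rewrite (_ : (fun _ => _) = fun z => if w < normc (empirical_fourier Y z)
    then v z else 0); last by apply/funext => z; rewrite GE; case: ifP.
  apply: measurable_fun_ifT => //; apply: measurableT_comp => //.
  by apply: measurable_funM => //; apply: measurable_funB; apply: measurable_funM => //;
    [exact: mImF|exact: mReF].
apply: le_trans (inv_fourier_error cf fM f_int T_int mReG mImG inv) _.
apply: (@le_trans _ _ ((2 * pi^-1)%:E * ((2 * w ^- 2)%:E *
    (\int[leb]_z (normc (fourier Psihat z + fourier f z * fourier q z) ^+ 2)%:E) +
   \int[leb]_z (error_density w (fourier f z) (fourier q z)
      (empirical_fourier Y z))%:E))%E).
  apply: lee_wpmul2l; first by rewrite lee_fin.
  apply: lower_integral_le.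
  - by rewrite mulr_gt0// invr_gt0 exprn_gt0.
  - by move=> z; rewrite lee_fin sqr_ge0.
  - by move=> z; rewrite lee_fin sqr_ge0.
  - by move=> z; rewrite lee_fin error_density_ge0.
  - apply/measurable_EFinP; apply: measurable_error_density => //.
    + exact: mReF.
    + exact: mImF.
    + exact: mReF.
    + exact: mImF.
  - by move=> z; rewrite -EFinM -EFinD lee_fin; exact: threshold_error.
have K0 : (0 <= \int[leb]_z (normc (fourier Psihat z + fourier f z * fourier q z) ^+ 2)%:E)%E.
  by apply: integral_ge0 => z _; rewrite lee_fin sqr_ge0.
have w20 : 0 <= 2 * w ^- 2 by rewrite mulr_ge0// invr_ge0 sqr_ge0.
rewrite ge0_muleDr//; last by rewrite mule_ge0// lee_fin.
apply: leeD => //.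
have m1 : measurable_fun [set: measurableTypeR R] (fun z => (trig_transform false D z ^+ 2)%:E).
  by apply/measurable_EFinP; apply: measurable_funX; exact: mT.
have m2 : measurable_fun [set: measurableTypeR R] (fun z => (trig_transform true D z ^+ 2)%:E).
  by apply/measurable_EFinP; apply: measurable_funX; exact: mT.
rewrite (_ : \int[leb]_z (normc _ ^+ 2)%:E = \int[leb]_z ((trig_transform false D z ^+ 2)%:E +
    (trig_transform true D z ^+ 2)%:E))%E; last first.
  apply: eq_integral => z _; rewrite -EFinD normc_sqr !TD !fourierE /=.
  rewrite (trig_transform_conv_cos mf fM f_int q_int).
  rewrite (trig_transform_conv_sin mf fM f_int q_int).
  by congr EFin; ring.
rewrite ge0_integralD//; last 2 first.
- by move=> z _; rewrite lee_fin sqr_ge0.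
- by move=> z _; rewrite lee_fin sqr_ge0.
apply: (@le_trans _ _ ((2 * pi^-1)%:E * ((2 * w ^- 2)%:E *
    ((2 * pi)%:E * I + (2 * pi)%:E * I)))%E).
  apply: lee_wpmul2l; first by rewrite lee_fin.
  apply: lee_wpmul2l; first by rewrite lee_fin.
  by rewrite IE; apply: leeD; exact: bessel.
have I0 : (0 <= I)%E by apply: integral_ge0 => y _; rewrite lee_fin sqr_ge0.
rewrite -ge0_muleDl ?lee_fin ?mulr_ge0 ?(ltW pi0)// -EFinD !muleA -!EFinM.
have E (r s : R) : r != 0 -> 2 * r^-1 * (2 * s) * (2 * r + 2 * r) = 16 * s.
  by move=> r0; field.
by rewrite E// gt_eqF.
Qed.

End SampleError.

(** * The expected error *)

Section MeanError.
Context d (Omega : measurableType d) (R : realType) (P : probability Omega R).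
Variables (N : nat) (Y : Omega -> 'I_N -> R) (q : R -> R) (r : R).
Hypotheses (N0 : (0 < N)%N) (mY : forall i, measurable_fun setT (fun om => Y om i))
  (mq : measurable_fun setT q) (q0 : forall x, 0 <= q x)
  (q1 : (\int[leb]_x (q x)%:E = 1)%E) (r0 : 0 < r)
  (W1r : (\int[P]_om (W1 (empirical_law (Y om)) (density_law q)) ^+ 2 <= r%:E)%E).

Let err b om z :=
  N%:R^-1 * \sum_(i < N) trig b (z * Y om i) - trig_transform b q z.

Let merr b z : measurable_fun setT (err b ^~ z).
Proof.
apply: measurable_funB => //; apply: measurable_funM => //; apply: measurable_sum => i.
apply: measurableT_comp; first exact: measurable_trig.
by apply: measurable_funM => //; exact: mY.
Qed.

(** The hypothesis bounds a lower integral of the squared distance, and lower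
    integrals are monotone. *)
Lemma mean_trig_error b z :
  (\int[P]_om (err b om z ^+ 2)%:E <= (z ^+ 2 * r)%:E)%E.
Proof.
have W0 om : (0 <= W1 (empirical_law (Y om)) (density_law q))%E.
  apply: le_ereal_inf_tmp => _ [gam _ <-].
  by apply: integral_ge0.
have le om : ((err b om z ^+ 2)%:E <=
    (z ^+ 2)%:E * W1 (empirical_law (Y om)) (density_law q) ^+ 2)%E.
  have h := W1_trig_le (Y om) N0 mq q0 q1 b z.
  rewrite -real_normK ?num_real// -[z ^+ 2]real_normK ?num_real//.
  rewrite !expr2 !EFinM expe2 muleACA.
  by apply: lee_pmul => //; rewrite lee_fin.
have [z0|z0] := eqVneq z 0.
  rewrite z0 expr0n/= mul0r.
  rewrite integral0_eq// => om _; apply/eqP; rewrite eq_le.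
  apply/andP; split; last by rewrite lee_fin sqr_ge0.
  by have := le om; rewrite z0 expr0n/= mul0e.
have z2 : 0 < z ^+ 2 by rewrite exprn_even_gt0.
apply: (@le_trans _ _ ((z ^+ 2)%:E *
    \int[P]_om (W1 (empirical_law (Y om)) (density_law q)) ^+ 2 + \int[P]_om 0)%E).
  apply: lower_integral_le => //.
  - by move=> om; rewrite lee_fin sqr_ge0.
  - by move=> om; exact: expe_ge0.
  - by move=> om; rewrite adde0.
rewrite integral0 adde0 (EFinM (z ^+ 2)); apply: lee_wpmul2l => //.
by rewrite lee_fin ltW.
Qed.

Lemma normc_emp_error om z : normc (empirical_fourier (Y om) z - fourier q z) ^+ 2 =
  err false om z ^+ 2 + err true om z ^+ 2.
Proof. by rewrite normc_sqr empirical_fourierE fourierE. Qed.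

Lemma measurable_normc_emp_error z :
  measurable_fun setT (fun om => normc (empirical_fourier (Y om) z - fourier q z) ^+ 2).
Proof.
rewrite (_ : (fun _ => _) = (fun om => err false om z ^+ 2 + err true om z ^+ 2)).
  by apply: measurable_funD; apply: measurable_funX; exact: merr.
by apply/funext => om; exact: normc_emp_error.
Qed.

Lemma mean_fourier_error z :
  (\int[P]_om (normc (empirical_fourier (Y om) z - fourier q z) ^+ 2)%:E <=
   (2 * z ^+ 2 * r)%:E)%E.
Proof.
under eq_integral do rewrite normc_emp_error EFinD.
have m b : measurable_fun setT (fun om => (err b om z ^+ 2)%:E).
  by apply/measurable_EFinP; apply: measurable_funX; exact: merr.
rewrite ge0_integralD//; last 2 first.
- by move=> om _; rewrite lee_fin sqr_ge0.
- by move=> om _; rewrite lee_fin sqr_ge0.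
rewrite (_ : 2 * z ^+ 2 * r = z ^+ 2 * r + z ^+ 2 * r); last ring.
by rewrite EFinD; apply: leeD; exact: mean_trig_error.
Qed.

Section Density.
Variables (w : R) (F : R -> R[i]).
Hypotheses (w0 : 0 < w)
  (mRe : measurable_fun setT (fun z => complex.Re (F z)))
  (mIm : measurable_fun setT (fun z => complex.Im (F z))).

Let Q z := fourier q z.
Let A z : R := if 2 * w < normc (Q z) then normc (F z) ^+ 2 * normc (Q z) ^- 2 * z ^+ 2 else 0.
Let B z : R := if normc (Q z) <= 2 * w then normc (F z) ^+ 2 else 0.

Let A0 z : 0 <= A z.
Proof.
rewrite /A; case: ifP => // _.
by apply: mulr_ge0; [apply: mulr_ge0|]; rewrite ?invr_ge0 sqr_ge0.
Qed.

Let B0 z : 0 <= B z.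
Proof. by rewrite /B; case: ifP => // _; rewrite sqr_ge0. Qed.

(** At a fixed frequency the error density is an affine function of |e - q|^2.
    *)
Lemma mean_error_density z :
  (\int[P]_om (error_density w (F z) (Q z) (empirical_fourier (Y om) z))%:E <=
   (4 * w ^- 2 * r * (normc (F z) ^+ 2 * z ^+ 2) + B z + 8 * r * A z)%:E)%E.
Proof.
pose c := 2 * w ^- 2 * normc (F z) ^+ 2 +
  (if 2 * w < normc (Q z) then 4 * (normc (F z) ^+ 2 * normc (Q z) ^- 2) else 0).
have w2 : 0 <= w ^- 2 by rewrite invr_ge0 sqr_ge0.
have c0 : 0 <= c.
  apply: addr_ge0; first by rewrite mulr_ge0 ?sqr_ge0// mulr_ge0.
  case: ifP => // _; apply: mulr_ge0 => //.
  by apply: mulr_ge0; rewrite ?invr_ge0 sqr_ge0.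
have E om : error_density w (F z) (Q z) (empirical_fourier (Y om) z) =
    c * normc (empirical_fourier (Y om) z - fourier q z) ^+ 2 + B z.
  by rewrite /error_density /c /B; case: (2 * w < _); ring.
under eq_integral do rewrite E EFinD EFinM.
have mX : measurable_fun setT
    (fun om => (normc (empirical_fourier (Y om) z - fourier q z) ^+ 2)%:E).
  by apply/measurable_EFinP; exact: measurable_normc_emp_error.
rewrite ge0_integralD//; last 3 first.
- by move=> om _; rewrite -EFinM lee_fin mulr_ge0// sqr_ge0.
- exact: measurable_funeM.
- by move=> om _; rewrite lee_fin.
have -> : (\int[P]_om (B z)%:E = (B z)%:E)%E.
  rewrite integral_cst// -[RHS]mule1; congr (_ * _)%E.
  exact: probability_setT.
rewrite ge0_integralZl//; last first.
  by move=> om _; rewrite lee_fin sqr_ge0.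
apply: (@le_trans _ _ (c%:E * (2 * z ^+ 2 * r)%:E + (B z)%:E)%E).
  by apply: leeD => //; apply: lee_wpmul2l; [rewrite lee_fin|exact: mean_fourier_error].
rewrite -EFinM -EFinD lee_fin le_eqVlt; apply/orP; left; apply/eqP.
by rewrite /c /A; case: ifP => _; ring.
Qed.

Let emp_meas b : measurable_fun setT
  (fun p : Omega * R => N%:R^-1 * \sum_(i < N) trig b (p.2 * Y p.1 i)).
Proof.
apply: measurable_funM => //; apply: measurable_sum => i.
apply: measurableT_comp; first exact: measurable_trig.
by apply: measurable_funM => //; exact: (measurableT_comp (mY i)).
Qed.

Lemma measurable_error_density_pair : measurable_fun setT
  (fun p : Omega * measurableTypeR R =>
     error_density w (F p.2) (Q p.2) (empirical_fourier (Y p.1) p.2)).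
Proof.
have mT b := measurable_trig_transform b mq.
apply: measurable_error_density.
- exact: (measurableT_comp mRe).
- exact: (measurableT_comp mIm).
- rewrite (_ : (fun _ => _) = (fun p : Omega * R => trig_transform false q p.2)).
    exact: (measurableT_comp (mT false)).
  by apply/funext => p; rewrite /Q fourierE.
- rewrite (_ : (fun _ => _) = (fun p : Omega * R => trig_transform true q p.2)).
    exact: (measurableT_comp (mT true)).
  by apply/funext => p; rewrite /Q fourierE.
- rewrite (_ : (fun _ => _) =
    (fun p : Omega * R => N%:R^-1 * \sum_(i < N) trig false (p.2 * Y p.1 i))).
    exact: (emp_meas false).
  by apply/funext => p; rewrite empirical_fourierE.
- rewrite (_ : (fun _ => _) =
    (fun p : Omega * R => N%:R^-1 * \sum_(i < N) trig true (p.2 * Y p.1 i))).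
    exact: (emp_meas true).
  by apply/funext => p; rewrite empirical_fourierE.
Qed.

(** Tonelli's theorem allows taking the expectation at each frequency first.
    *)
Lemma mean_integral_error_density :
  (\int[P]_om \int[leb]_z
     (error_density w (F z) (Q z) (empirical_fourier (Y om) z))%:E <=
   (4 * w ^- 2 * r)%:E * \int[leb]_z (normc (F z) ^+ 2 * z ^+ 2)%:E +
   ((8 * r)%:E * \int[leb]_(z in [set z | (2 * w < normc (fourier q z))%R])
       (normc (F z) ^+ 2 * normc (fourier q z) ^- 2 * z ^+ 2)%:E +
    \int[leb]_(z in [set z | (normc (fourier q z) <= 2 * w)%R])
       (normc (F z) ^+ 2)%:E))%E.
Proof.
pose h (p : Omega * measurableTypeR R) : \bar R :=
  (error_density w (F p.2) (Q p.2) (empirical_fourier (Y p.1) p.2))%:E.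
have mh : measurable_fun setT h.
  by apply/measurable_EFinP; exact: measurable_error_density_pair.
have h0 p : (0 <= h p)%E by rewrite lee_fin error_density_ge0.
rewrite [leLHS](@fubini_tonelli _ _ _ _ R P leb h mh h0).
have mF := measurable_normc mRe mIm.
have mQ : measurable_fun setT (fun z => normc (Q z)).
  apply: measurable_normc.
    rewrite (_ : (fun _ => _) = trig_transform false q).
      exact: measurable_trig_transform.
    by apply/funext => z; rewrite /Q fourierE.
  rewrite (_ : (fun _ => _) = trig_transform true q).
    exact: measurable_trig_transform.
  by apply/funext => z; rewrite /Q fourierE.
have mB : measurable_fun [set: measurableTypeR R] (fun z => (B z)%:E).
  apply/measurable_EFinP; apply: measurable_fun_ifT => //.
    exact: measurable_fun_ler.
  exact: measurable_funX.
have mA : measurable_fun [set: measurableTypeR R] (fun z => (A z)%:E).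
  apply/measurable_EFinP; apply: measurable_fun_ifT => //.
    exact: measurable_fun_ltr.
  apply: measurable_funM; last exact: measurable_funX.
  apply: measurable_funM; first exact: measurable_funX.
  by apply: (measurableT_comp (@measurable_inv R)); exact: measurable_funX.
have w2 : 0 < w ^- 2 by rewrite invr_gt0 exprn_gt0.
apply: (@le_trans _ _ ((4 * w ^- 2 * r)%:E * \int[leb]_z (normc (F z) ^+ 2 * z ^+ 2)%:E +
   \int[leb]_z (8 * r * A z + B z)%:E)%E).
  apply: lower_integral_le.
  - by rewrite !mulr_gt0.
  - by move=> z; apply: integral_ge0 => om _; exact: h0.
  - by move=> z; rewrite lee_fin mulr_ge0 ?sqr_ge0.
  - by move=> z; rewrite lee_fin addr_ge0// mulr_ge0// mulr_ge0// ltW.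
  - apply/measurable_EFinP; apply: measurable_funD; last exact/measurable_EFinP.
    by apply: measurable_funM => //; exact/measurable_EFinP.
  - move=> z; apply: le_trans (mean_error_density z) _.
    by rewrite -EFinM -EFinD lee_fin -addrA lerD2l addrC.
apply: leeD => //.
rewrite [X in (_ * X + _)%E]integral_mkcond [X in (_ + X)%E]integral_mkcond.
apply: lower_integral_le.
- by rewrite mulr_gt0.
- by move=> z; rewrite lee_fin addr_ge0// mulr_ge0// mulr_ge0// ltW.
- move=> z; apply: erestrict_ge0 => y _; rewrite lee_fin.
  by apply: mulr_ge0; [apply: mulr_ge0|]; rewrite ?invr_ge0 sqr_ge0.
- by move=> z; apply: erestrict_ge0 => y _; rewrite lee_fin sqr_ge0.
- rewrite (_ : _ \_ _ = (fun z => (B z)%:E))//.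
  apply/funext => z; rewrite /patch /B /Q; case: (leP (normc _)) => hz.
    by rewrite ifT// inE.
  by rewrite ifF//; apply/negbTE; rewrite notin_setE/= leNgt hz.
- move=> z; rewrite EFinD EFinM /patch /A /B /Q.
  case: (leP (normc _)) => hz.
    rewrite ifF; last by apply/negbTE; rewrite notin_setE/= ltNge hz.
    by rewrite ifT// inE.
  rewrite ifT ?inE// ifF//; apply/negbTE; rewrite notin_setE/=.
  by rewrite leNgt hz.
Qed.

End Density.
End MeanError.

(** * Measurability of the estimated score and the bound *)

Section ScoreMeasurable.
Context (R : realType).

Lemma measurable_rescale (u : R) (f : R -> R) : measurable_fun setT f ->
  measurable_fun setT (rescale u f).
Proof.
move=> mf; apply: measurable_funM => //; apply: measurableT_comp => //.
Qed.

Lemma measurable_kernel_sum (K : R -> R) (u c : R) N (Y : 'I_N -> R) :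
  measurable_fun setT K ->
  measurable_fun setT (fun y : R => c * \sum_(i < N) rescale u K (y - Y i)).
Proof.
move=> mK; apply: measurable_funM => //; apply: measurable_sum => i.
apply: measurableT_comp; first exact: measurable_rescale.
exact: measurable_funB.
Qed.

(** The smoothing kernel and its derivative are continuous, and division is
    measurable even where the estimated density vanishes. *)
Lemma measurable_score_est m (K : R -> R) (h0 h1 dlt : R) N (Y : 'I_N -> R) :
  smooth_kernel m K -> measurable_fun setT (score_est K h0 h1 dlt Y).
Proof.
case=> sK _ _ _ _.
have mK : measurable_fun setT K.
  by apply: continuous_measurable_fun; apply: derivable_continuous; exact: (sK 0%N).
have mK' : measurable_fun setT K^`().
  by apply: continuous_measurable_fun; apply: derivable_continuous; exact: (sK 1%N).
have md : measurable_fun setT (density_est K h0 Y) by exact: measurable_kernel_sum.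
apply: measurable_fun_ifT => //; first exact: measurable_fun_ltr.
apply: measurable_funM; first exact: measurable_kernel_sum.
exact: (measurableT_comp (@measurable_inv R)).
Qed.

Lemma continuous_derive_basis (p : interaction R) (j : nat) :
  continuous ((basis p j)^`() : R -> R).
Proof.
rewrite /basis; case: (j <= deg p)%N.
  rewrite (_ : (fun y : R => y ^+ (2 * j))^`() = (fun y => (2 * j)%:R * y ^+ (2 * j).-1)).
    by move=> x; apply: cvgM; [exact: cvg_cst|exact: exprn_continuous].
  by apply/funext => x; rewrite exp_derive1.
set c := freq p j.
rewrite (_ : (fun y : R => cos (c * y))^`() = (fun y => - sin (c * y) * c)).
  move=> x; apply: cvgM; last exact: cvg_cst.
  by apply: cvgN; exact: (@continuous_mulr_comp _ _ c (@continuous_sin R)).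
apply/funext => x.
have ds := is_derive1_comp (is_derive_cos (c * x)) (is_derive_mulr c x).
by rewrite derive1E; exact: derive_val.
Qed.

Lemma measurable_score_par (p : interaction R) (a : 'rV[R]_(dim p)) :
  measurable_fun setT (fun y => score_par y a).
Proof.
apply: measurableT_comp => //; apply: measurable_sum => i.
apply: measurable_funM => //; apply: continuous_measurable_fun.
exact: continuous_derive_basis.
Qed.

Lemma measurable_Psi_est (p : interaction R) (l : R -> R) (a : 'rV[R]_(dim p)) (eps U : R) :
  measurable_fun setT l -> measurable_fun setT (Psi_est l a eps U).
Proof.
move=> ml; apply: measurable_fun_ifT => //.
  by apply: measurable_fun_ler => //; exact: measurableT_comp.
by apply: measurable_funB => //; exact: measurable_score_par.
Qed.

End ScoreMeasurable.

Theorem proposition4p5 (R : realType) (p : interaction R) (lam : R)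
  (p_adm : admissible p lam)
  (dens : R -> R) (dens_inv : invariant_density p dens)
  (d : measure_display) (Omega : measurableType d) (P : probability Omega R)
  (B : nat -> R -> {RV P >-> R}) (X0 : nat -> {RV P >-> R})
  (noise : driving_noise B X0)
  (X : forall N, 'I_N -> R -> {RV P >-> R}) (X_sol : particle_system p B X0 X)
  (C1 C2 : R) (C1_gt0 : 0 < C1) (C2_gt0 : 0 < C2)
  (W1_bound : forall (N : nat) (T : R), (0 < N)%N -> 0 <= T ->
    (\int[P]_om (W1 (empirical_law (centered X N T om))
                    (density_law dens)) ^+ 2
     <= ((rate C1 C2 lam N T)^-1)%:E)%E)
  (K : R -> R) (m : nat) (m_ge2 : (2 <= m)%N) (K_kernel : smooth_kernel m K)
  (eps : R) (eps_gt0 : 0 < eps) (eps_lt1 : eps < 1)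
  (w : R -> R) (w_weight : weight eps w)
  (beta''_L2 : (beta p)^`()^`() \in Lfun (@lebesgue_measure R) 2%:E) :
  exists2 C : R, 0 < C &
  forall (U thr : nat -> R -> R)
    (U_ge1 : forall N T, 1 <= U N T)
    (U_cvg : (fun q => U q.1 q.2) @ filter_prod \oo +oo --> +oo)
    (thr_gt0 : forall N T, 0 < thr N T)
    (thr_cvg : (fun q => thr q.1 q.2) @ filter_prod \oo +oo --> 0)
    (alphaNT : forall (N : nat) (T : R), Omega -> 'rV[R]_(dim p))
    (beta'NT : forall (N : nat) (T : R), Omega -> R -> R),
  let Y N T om : 'I_N -> R := centered X N T om in
  let NT N T := rate C1 C2 lam N T in
  let lNT N T om :=
    score_est K (bandwidth0 m (NT N T)) (bandwidth1 m (NT N T))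
      (delta p dens (U N T)) (Y N T om) in
  let PsiNT N T om := Psi_est (lNT N T om) (alphaNT N T om) eps (U N T) in
  (forall (N : nat) (T : R) (om : Omega), (0 < N)%N -> 0 <= T ->
    is_argmin (contrast (lNT N T om) w (U N T)) (alphaNT N T om)) ->
  (forall (N : nat) (T : R) (om : Omega), (0 < N)%N -> 0 <= T ->
    is_inv_fourier (fourier_beta'_est (Y N T om) (PsiNT N T om) (thr N T))
      (beta'NT N T om)) ->
  forall (N : nat) (T : R), (0 < N)%N -> 0 <= T ->
  (\int[P]_om \int[leb]_y ((beta'NT N T om y - (beta p)^`() y) ^+ 2)%:E
   <= C%:E *
      ((thr N T ^- 2)%:E *
         (\int[P]_om \int[leb]_y ((PsiNT N T om y - Psi p dens y) ^+ 2)%:E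
          + ((NT N T)^-1)%:E)
       + ((NT N T)^-1)%:E *
         \int[leb]_(z in [set z | (2 * thr N T < normc (fourier dens z))%R])
           ((normc (fourier (beta p)^`() z)) ^+ 2
            * (normc (fourier dens z)) ^- 2 * z ^+ 2)%:E
       + \int[leb]_(z in [set z | (normc (fourier dens z) <= 2 * thr N T)%R])
           ((normc (fourier (beta p)^`() z)) ^+ 2)%:E))%E.
Proof.
set f := (beta p)^`().
have f_deriv (x : R) : is_derive x 1 f (f^`() x).
  by rewrite derive1E; apply/derivableP; exact: (adm_derivable2 p_adm).
have cf : continuous f by apply: derivable_continuous; exact: (adm_derivable2 p_adm).
have [M fM] := adm_bounded1 p_adm.
have f_int : leb.-integrable setT (EFin \o f) := adm_integrable1 p_adm.
have mf : measurable_fun setT f by exact: continuous_measurable_fun.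
have cdf : continuous (f^`() : R -> R) := adm_C2 p_adm.
have mdf : measurable_fun setT f^`() by exact: continuous_measurable_fun.
have df2 : (\int[leb]_x (f^`() x ^+ 2)%:E < +oo)%E.
  have /integrableP[_] := Lfun2_integrable_sqr beta''_L2.
  by under eq_integral do rewrite /= ger0_norm ?sqr_ge0//.
have f2 : (\int[leb]_x (f x ^+ 2)%:E < +oo)%E := sqr_bounded_lty f_int fM.
have zT2 b : (\int[leb]_z ((z * trig_transform b f z) ^+ 2)%:E < +oo)%E.
  apply: le_lt_trans (integral_trig_transform_deriv f_deriv cdf f_int b) _.
  rewrite lte_mul_pinfty ?lee_fin ?mulr_ge0 ?pi_ge0//.
  apply: (@le_lt_trans _ _ (2%:E * \int[leb]_x (f^`() x ^+ 2)%:E +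
      \int[leb]_x (8 * f x ^+ 2)%:E)%E).
    apply: lower_integral_le => //.
    - by move=> x; rewrite lee_fin addr_ge0// mulr_ge0// sqr_ge0.
    - by move=> x; rewrite lee_fin sqr_ge0.
    - by move=> x; rewrite lee_fin mulr_ge0// sqr_ge0.
    - by apply/measurable_EFinP; apply: measurable_funM => //; exact: measurable_funX.
  have -> : (\int[leb]_x (8 * f x ^+ 2)%:E = 8%:E * \int[leb]_x (f x ^+ 2)%:E)%E.
    rewrite -ge0_integralZl//.
    - by apply/measurable_EFinP; exact: measurable_funX.
    - by move=> x _; rewrite lee_fin sqr_ge0.
  apply: lte_add_pinfty; (apply: lte_mul_pinfty; first by rewrite lee_fin);
    [by []|exact: df2|by []|exact: f2].
have T_int b : leb.-integrable setT (EFin \o trig_transform b f).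
  exact: integrable_trig_transform.
pose Kint := (\int[leb]_z (normc (fourier f z) ^+ 2 * z ^+ 2)%:E)%E.
have Kint0 : (0 <= Kint)%E.
  by apply: integral_ge0 => z _; rewrite lee_fin mulr_ge0 ?sqr_ge0.
have Kinty : (Kint < +oo)%E.
  rewrite /Kint.
  apply: (@le_lt_trans _ _ (1%:E * \int[leb]_z ((z * trig_transform false f z) ^+ 2)%:E +
      \int[leb]_z ((z * trig_transform true f z) ^+ 2)%:E)%E).
    apply: lower_integral_le => //.
    - by move=> z; rewrite lee_fin mulr_ge0 ?sqr_ge0.
    - by move=> z; rewrite lee_fin sqr_ge0.
    - by move=> z; rewrite lee_fin sqr_ge0.
    - apply/measurable_EFinP; apply: measurable_funX; apply: measurable_funM => //.
      exact: measurable_trig_transform.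
    - move=> z; rewrite mul1e -EFinD lee_fin normc_sqr fourierE /=.
      by rewrite !exprMn mulrDl ![_ * z ^+ 2]mulrC.
  by rewrite mul1e lte_add_pinfty.
pose k := fine Kint.
have k0 : 0 <= k by exact: fine_ge0.
have EK : Kint = k%:E by rewrite fineK// ge0_fin_numE.
have mq := inv_measurable dens_inv.
have q0 := inv_ge0 dens_inv; have q1 := inv_mass dens_inv.
have q_int := integrable_density mq q0 q1.
(* 16 is the constant of the sample error, which multiplies the error on Psi.
   The expected error density brings 4 k for the term in thr^-2 / N_T, with k
   the integral of z^2 |F(z)|^2, and 8 and 1 for the two integrals over z. *)
exists (16 + 4 * k); first by rewrite ltr_wpDr// mulr_ge0.
move=> U thr U_ge1 U_cvg thr_gt0 thr_cvg alphaNT beta'NT Y NT lNT PsiNT _ inv N T N0 T0.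
set om2 := thr N T; have om2_gt0 : 0 < om2 := thr_gt0 N T.
have r_gt0 : 0 < (NT N T)^-1.
  rewrite invrK addr_gt0 ?mulr_gt0 ?expR_gt0//.
  by rewrite invr_gt0 ltr0n.
set r := (NT N T)^-1.
have mY i : measurable_fun setT (fun om => Y N T om i).
  apply: measurable_funB; first exact: measurable_funP.
  by apply: measurable_funM => //; apply: measurable_sum => j; exact: measurable_funP.
have mP om : measurable_fun setT (PsiNT N T om).
  by apply: measurable_Psi_est; exact: (measurable_score_est _ _ _ _ K_kernel).
have PL om y : eps * U N T < `|y| -> PsiNT N T om y = 0.
  by rewrite /PsiNT /Psi_est ltNge => /negbTE ->.
have mRe : measurable_fun setT (fun z => complex.Re (fourier f z)).
  rewrite (_ : (fun _ => _) = trig_transform false f).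
    exact: measurable_trig_transform.
  by apply/funext => z; rewrite fourierE.
have mIm : measurable_fun setT (fun z => complex.Im (fourier f z)).
  rewrite (_ : (fun _ => _) = trig_transform true f).
    exact: measurable_trig_transform.
  by apply/funext => z; rewrite fourierE.
set E := (\int[P]_om \int[leb]_y ((PsiNT N T om y - Psi p dens y) ^+ 2)%:E)%E.
set A := (\int[leb]_(z in [set z | (2 * om2 < normc (fourier dens z))%R]) _)%E.
set D := (\int[leb]_(z in [set z | (normc (fourier dens z) <= 2 * om2)%R]) _)%E.
have E0 : (0 <= E)%E.
  by apply: integral_ge0 => om _; apply: integral_ge0 => y _; rewrite lee_fin sqr_ge0.
have A0 : (0 <= A)%E.
  apply: integral_ge0 => z _; rewrite lee_fin.
  by apply: mulr_ge0; [apply: mulr_ge0|]; rewrite ?invr_ge0 sqr_ge0.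
have D0 : (0 <= D)%E by apply: integral_ge0 => z _; rewrite lee_fin sqr_ge0.
pose err om z := error_density om2 (fourier f z) (fourier dens z)
  (empirical_fourier (Y N T om) z).
have merr : measurable_fun setT (fun om => \int[leb]_z (err om z)%:E)%E.
  have mh := measurable_error_density_pair mY mq om2 mRe mIm.
  apply: (@measurable_fun_fubini_tonelli_F _ _ Omega (measurableTypeR R) R leb
    (fun q : Omega * measurableTypeR R => (err q.1 q.2)%:E)).
  - exact/measurable_EFinP.
  - by move=> q; rewrite lee_fin error_density_ge0.
have mean := mean_integral_error_density N0 mY mq q0 q1 r_gt0 (W1_bound N T N0 T0)
  om2_gt0 mRe mIm.
have v0 : 0 < om2 ^- 2 by rewrite invr_gt0 exprn_gt0.
have pi0 := @pi_gt0 R.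
(* the constant 2 / pi of the inversion in the mean is at most 1 *)
have pi1 : 2 * (pi : R)^-1 <= 1 by rewrite ler_pdivrMr// mul1r pi_ge2.
have pi2 : 0 <= 2 * (pi : R)^-1 by rewrite mulr_ge0// invr_ge0 ltW.
have I0 om : (0 <= \int[leb]_z (err om z)%:E)%E.
  by apply: integral_ge0 => z _; rewrite lee_fin error_density_ge0.
apply: (@le_trans _ _ ((16 * om2 ^- 2)%:E * E + \int[P]_om \int[leb]_z (err om z)%:E)%E).
  apply: lower_integral_le => //.
  - by rewrite mulr_gt0.
  - by move=> om; apply: integral_ge0 => y _; rewrite lee_fin sqr_ge0.
  - by move=> om; apply: integral_ge0 => y _; rewrite lee_fin sqr_ge0.
  move=> om; apply: le_trans (sample_error cf fM f_int q_int T_int om2_gt0 (mP om) (PL om)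
    (inv N T om N0 T0)) _.
  apply: leeD => //.
  by rewrite -[leRHS]mul1e; apply: lee_wpmul2r; rewrite ?lee_fin//; exact: I0.
apply: (@le_trans _ _ ((16 * om2 ^- 2)%:E * E + ((4 * om2 ^- 2 * r)%:E * k%:E +
   ((8 * r)%:E * A + D)))%E).
  by apply: leeD => //; rewrite -EK; exact: mean.
have c16 : 16 <= 16 + 4 * k by rewrite lerDl mulr_ge0.
have rE0 : (0 <= r%:E)%E by rewrite lee_fin ltW.
have vE0 : (0 <= (om2 ^- 2)%:E)%E by rewrite lee_fin ltW.
have Er0 : (0 <= E + r%:E)%E by exact: adde_ge0.
have vEr0 : (0 <= (om2 ^- 2)%:E * (E + r%:E))%E by exact: mule_ge0.
have rA0 : (0 <= r%:E * A)%E by exact: mule_ge0.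
have vE : (0 <= (om2 ^- 2)%:E * E)%E by exact: mule_ge0.
have vr : (0 <= (om2 ^- 2)%:E * r%:E)%E by exact: mule_ge0.
have vrA : (0 <= (om2 ^- 2)%:E * (E + r%:E) + r%:E * A)%E by exact: adde_ge0.
rewrite (ge0_muleDr _ vrA D0) (ge0_muleDr _ vEr0 rA0) (ge0_muleDr _ E0 rE0).
rewrite (ge0_muleDr _ vE vr).
rewrite -!addeA; apply: leeD; last apply: leeD; last apply: leeD.
- rewrite muleA -EFinM; apply: lee_wpmul2r => //.
  by rewrite lee_fin ler_wpM2r// ltW.
- rewrite -!EFinM lee_fin (_ : 4 * _ * r * k = 4 * k * (om2 ^- 2 * r)); last ring.
  by rewrite ler_wpM2r ?lerDr// mulr_ge0// ltW.
- rewrite muleA -EFinM; apply: lee_wpmul2r => //.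
  by rewrite lee_fin ler_wpM2r ?ltW//; lra.
- by rewrite -[leLHS]mul1e; apply: lee_wpmul2r => //; rewrite lee_fin; lra.
Qed.
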